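(* Let $G$ be a group, let $A$ be an abelian group (with trivial $G$-action), and let $\alpha\colon G^3\to A$ be a normalized 3-cocycle. Let $G_\alpha$ be the skeletal 2-group with underlying group of objects $G$, automorphism group $A$ and associator $\alpha$, regarded as an extension of $G$ by $BA$ via the sequence $BA\to G_\alpha\to G$. Let $c_\alpha\colon BG\to B^3A$ be the morphism of pointed $\infty$-groupoids represented by $\alpha$. Then the 2-group extension $BA\to G_\alpha\to G$ is equivalent, as an extension of $\infty$-groups, to the $\infty$-group extension of $G$ by $BA$ classified by $c_\alpha$. Explicitly, there is an equivalence of pointed $\infty$-groupoids $BG_\alpha\simeq \mathrm{hofib}(c_\alpha)$ which is compatible, up to homotopy, with the maps to $BG$ and with the maps from $B^2A$.
   Context: Cocycles: $A$ is written multiplicatively. A normalized 3-cocycle is a function $\alpha\colon G^3\to A$ with $\alpha(g,h,k)\,\alpha(f,gh,k)\,\alpha(f,g,h)=\alpha(fg,h,k)\,\alpha(f,g,hk)$ for all $f,g,h,k\in G$, and $\alpha(g,h,k)=1$ whenever one of $g,h,k$ is the identity. 2-groups: A 2-group is a monoidal category in which every morphism is invertible and every object $x$ has a weak inverse $x^{-1}$ with $x\otimes x^{-1}\cong 1$. The 2-group $G_\alpha$ has the elements of $G$ as objects, $\mathrm{Hom}(g,g)=A$ and $\mathrm{Hom}(g,h)=\emptyset$ for $g\ne h$, and composition is multiplication in $A$. The monoidal product is $g\otimes h=gh$ on objects and $a\otimes b=ab$ on morphisms. The unitors are identities, and the associator $(f\otimes g)\otimes h\to f\otimes(g\otimes h)$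 is $\alpha(f,g,h)\in A=\mathrm{Aut}(fgh)$. The sequence $BA\to G_\alpha\to G$: Here $BA$ is the one-object groupoid with automorphism group $A$, a 2-group since $A$ is abelian. The monoidal functor $BA\to G_\alpha$ sends the unique object to the unit $1$ and is the identity $A\to\mathrm{Aut}(1)$ on morphisms. The functor $G_\alpha\to G$ is 0-truncation: it is the identity on objects and forgets automorphisms, where $G$ is a discrete monoidal category. Deloopings and $\infty$-groupoids: $\infty$-groupoids are modelled by Kan complexes. An $\infty$-group $H$ is identified with its delooping $BH$, a pointed connected $\infty$-groupoid with loop space $H$. The delooping of a 2-group is the one-object bicategory whose 1-morphisms are the objects of the 2-group, whose 2-morphisms are its morphisms, and in which composition of 1-morphisms ($f$ followed by $g$) is $f\otimes g$. It is regarded as a Kan complex via its Duskin nerve, whose $n$-simplices are the strictly unitary lax functors from the linearly ordered set $\{0<\dots<n\}$ to the bicategory. For the discrete 2-group $G$ this gives the usual nerve $BG$ with $(BG)_n=G^n$. Delooping $BA\to G_\alpha\to G$ gives pointed maps $B^2A\to BG_\alpha\to BG$. The map $c_\alpha$: $B^nA$ denotes the $n$-fold delooping of $A$, i.e. the Eilenberg–MacLane space $K(A,n)$, modelled by the simplicial abelian group that the Dold–Kan correspondence assigns to $A$ placed in degree $n$. Simplicial maps $BG\to B^3A$ correspond to normalized $A$-valued simplicial 3-cocycles on $BG$, and $c_\alpha$ is the map corresponding to $(f,g,h)\mapsto\alpha(f,g,h)$. Classified extension: The $\infty$-group extension of $G$ by $BA$ classified by a pointed morphism $c\colon BG\to B^3A$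 is the loop space of the homotopy fiber $\mathrm{hofib}(c)$ (the homotopy pullback of $c$ along the base point $*\to B^3A$), with the maps obtained by looping the fiber sequence $B^2A\simeq\Omega B^3A\to\mathrm{hofib}(c)\to BG$. The identification $B^2A\simeq\Omega B^3A$ is one of the two standard ones, which differ by the inversion $a\mapsto a^{-1}$ of $A$. Which one is used is a fixed sign convention, independent of $G$ and $\alpha$. *)

(* Defs.v *)
From mathcomp Require Import all_boot all_algebra.
From Stdlib Require Import FunctionalExtensionality ProofIrrelevance.

Set Implicit Arguments.
Unset Strict Implicit.
Unset Printing Implicit Defensive.

Import GRing.Theory.

#[local] Obligation Tactic := idtac.

(* The finite ordinal [n] = {0 < ... < n} has underlying type ['I_n.+1]. *)
Record mono (m n : nat) := Mono {
  mono_fun :> 'I_m.+1 -> 'I_n.+1;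
  mono_le : forall i j : 'I_m.+1, i <= j -> mono_fun i <= mono_fun j }.

Lemma mono_eq m n (s t : mono m n) : s =1 t -> s = t.
Proof.
case: s t => [f p] [g q] /= /functional_extensionality efg.
by case: g / efg q => q; rewrite (proof_irrelevance _ p q).
Qed.

Definition mono_id n : mono n n := @Mono n n id (fun _ _ le_ij => le_ij).

Definition mono_comp l m n (t : mono m n) (s : mono l m) : mono l n :=
  @Mono l n (fun i => t (s i)) (fun _ _ le_ij => mono_le t (mono_le s le_ij)).

Definition mono_const m n (k : 'I_n.+1) : mono m n :=
  @Mono m n (fun _ => k) (fun _ _ _ => leqnn k).

Lemma lift_le n (i : 'I_n.+2) (j k : 'I_n.+1) : j <= k -> lift i j <= lift i k.
Proof. by rewrite /= leq_bump2. Qed.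

Definition coface n (i : 'I_n.+2) : mono n n.+1 := Mono (@lift_le n i).

Record sset := SSet {
  simp :> nat -> Type;
  act : forall m n, mono m n -> simp n -> simp m;
  act_id : forall n (x : simp n), act (mono_id n) x = x;
  act_comp : forall l m n (t : mono m n) (s : mono l m) (x : simp n),
    act (mono_comp t s) x = act s (act t x) }.

Record smap (X Y : sset) := SMap {
  smap_fun :> forall n, X n -> Y n;
  smap_nat : forall m n (t : mono m n) (x : X n),
    smap_fun (act t x) = act t (smap_fun x) }.

Lemma smap_eq (X Y : sset) (f g : smap X Y) :
  (forall n (x : X n), f n x = g n x) -> f = g.
Proof.
case: f g => [f p] [g q] /= efg.
have {}efg : f = g.
  by do 2![apply: functional_extensionality_dep => ?]; apply: efg.
by case: g / efg q => q; rewrite (proof_irrelevance _ p q).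
Qed.

Definition sid (X : sset) : smap X X := @SMap X X (fun _ x => x) (fun _ _ _ _ => erefl).

Program Definition scomp (X Y Z : sset) (g : smap Y Z) (f : smap X Y) : smap X Z :=
  @SMap X Z (fun n x => g n (f n x)) _.
Next Obligation. by move=> * /=; rewrite !smap_nat. Qed.

Program Definition Delta (n : nat) : sset :=
  @SSet (fun m => mono m n) (fun _ _ t s => mono_comp s t) _ _.
Next Obligation. by move=> n m [f p]. Qed.
Next Obligation. by []. Qed.

Definition Delta_map m n (t : mono m n) : smap (Delta m) (Delta n) :=
  @SMap (Delta m) (Delta n) (fun _ s => mono_comp t s) (fun _ _ _ _ => erefl).

Program Definition yoneda (X : sset) n (x : X n) : smap (Delta n) X :=
  @SMap (Delta n) X (fun _ s => act s x) _.
Next Obligation. by move=> X n x l m t s /=; rewrite act_comp. Qed.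

Program Definition sprod (X Y : sset) : sset :=
  @SSet (fun n => (X n * Y n)%type) (fun _ _ t x => (act t x.1, act t x.2)) _ _.
Next Obligation. by move=> X Y n [x y] /=; rewrite !act_id. Qed.
Next Obligation. by move=> X Y l m n t s [x y] /=; rewrite !act_comp. Qed.

Program Definition sprod_map (X Y X' Y' : sset) (f : smap X X') (g : smap Y Y') :
    smap (sprod X Y) (sprod X' Y') :=
  @SMap (sprod X Y) (sprod X' Y') (fun n x => (f n x.1, g n x.2)) _.
Next Obligation. by move=> X Y X' Y' f g m n t [x y] /=; rewrite !smap_nat. Qed.

(* Vertices of the interval [Delta 1], as simplices of arbitrary dimension. *)
Definition src n : Delta 1 n := mono_const n ord0.
Definition tgt n : Delta 1 n := mono_const n ord_max.

Record psset := PSSet { psset_sset :> sset; pt : psset_sset 0 }.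

Definition ptn (X : psset) n : X n := act (mono_const n ord0) (pt X).

Record pmap (X Y : psset) := PMap {
  pmap_smap :> smap X Y;
  pmap_pt : pmap_smap 0 (pt X) = pt Y }.

Definition pid (X : psset) : pmap X X := @PMap X X (sid X) erefl.

Program Definition pcomp (X Y Z : psset) (g : pmap Y Z) (f : pmap X Y) : pmap X Z :=
  @PMap X Z (scomp g f) _.
Next Obligation. by move=> X Y Z g f /=; rewrite !pmap_pt. Qed.

(* All simplicial sets compared below are Kan complexes; between those,
   one-step simplicial homotopy is an equivalence relation, and the
   homotopy equivalences are exactly the weak equivalences. *)
Definition pointed_homotopic (X Y : psset) (f g : pmap X Y) : Prop :=
  exists H : smap (sprod X (Delta 1)) Y,
    [/\ forall n (x : X n), H n (x, src n) = f n x,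
        forall n (x : X n), H n (x, tgt n) = g n x
      & forall n (t : Delta 1 n), H n (ptn X n, t) = ptn Y n].

Definition pointed_equivalence (X Y : psset) (f : pmap X Y) : Prop :=
  exists g : pmap Y X,
    pointed_homotopic (pcomp g f) (pid X) /\ pointed_homotopic (pcomp f g) (pid Y).

(* A delooped sequence [B F -> B E -> B H] of infinity-groups, with its total
   space left variable: an extension of [H] by [F]. *)
Record extension (BF BH : psset) := Extension {
  ext_total : psset;
  ext_incl : pmap BF ext_total;
  ext_proj : pmap ext_total BH }.

Definition extension_equivalent (BF BH : psset) (E E' : extension BF BH) : Prop :=
  exists phi : pmap (ext_total E) (ext_total E'),
    [/\ pointed_equivalence phi,
        pointed_homotopic (pcomp (ext_proj E') phi) (ext_proj E)
      & pointed_homotopic (pcomp phi (ext_incl E)) (ext_incl E')].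

(* The strict pullback of [X], [Z^(Delta 1)] and [Y] over [Z * Z], a model of
   the homotopy pullback since [Z] is Kan; paths run from [f x] to [g y]. *)
Record hpb_simplex (X Y Z : sset) (f : smap X Z) (g : smap Y Z) n := HpbSimplex {
  hpb_fst : X n;
  hpb_snd : Y n;
  hpb_path : smap (sprod (Delta n) (Delta 1)) Z;
  hpb_ends : forall m (t : mono m n),
    hpb_path m (t, src m) = act t (f n hpb_fst) /\
    hpb_path m (t, tgt m) = act t (g n hpb_snd) }.

Lemma hpb_eq (X Y Z : sset) (f : smap X Z) (g : smap Y Z) n
    (u v : hpb_simplex f g n) :
  hpb_fst u = hpb_fst v -> hpb_snd u = hpb_snd v ->
  (forall m (t : mono m n) (s : Delta 1 m),
     hpb_path u m (t, s) = hpb_path v m (t, s)) -> u = v.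
Proof.
case: u v => [x y h p] [x' y' h' p'] /= ex ey eh.
have {}eh : h = h' by apply: smap_eq => m [t s]; apply: eh.
case: x' / ex p' => p'; case: y' / ey p' => p'; case: h' / eh p' => p'.
by rewrite (proof_irrelevance _ p p').
Qed.

Program Definition hpb_act (X Y Z : sset) (f : smap X Z) (g : smap Y Z) m n
    (t : mono m n) (u : hpb_simplex f g n) : hpb_simplex f g m :=
  @HpbSimplex X Y Z f g m (act t (hpb_fst u)) (act t (hpb_snd u))
    (scomp (hpb_path u) (sprod_map (Delta_map t) (sid (Delta 1)))) _.
Next Obligation.
move=> X Y Z f g m n t u l s /=; rewrite !smap_nat -!act_comp.
exact: hpb_ends u _ (mono_comp t s).
Qed.

Program Definition hpb (X Y Z : sset) (f : smap X Z) (g : smap Y Z) : sset :=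
  @SSet (hpb_simplex f g) (@hpb_act X Y Z f g) _ _.
Next Obligation.
by move=> X Y Z f g n u; apply: hpb_eq => [||m [t p] s] /=; rewrite ?act_id.
Qed.
Next Obligation.
by move=> X Y Z f g l m n t s u; apply: hpb_eq => [||k r q] /=; rewrite ?act_comp.
Qed.

Definition sconst (X Z : sset) (z : Z 0) : smap X Z :=
  @SMap X Z (fun n _ => act (mono_const n ord0) z)
    (fun m n t _ => act_comp (mono_const n ord0) t z).

Program Definition phpb (X Y Z : psset) (f : pmap X Z) (g : pmap Y Z) : psset :=
  @PSSet (hpb f g)
    (@HpbSimplex X Y Z f g 0 (pt X) (pt Y) (sconst _ (pt Z)) _).
Next Obligation.
move=> X Y Z f g m t /=; rewrite !pmap_pt.
by split; congr act; apply: mono_eq => i; rewrite [t i]ord1.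
Qed.

Definition point : psset := @PSSet (Delta 0) (mono_id 0).

Program Definition point_incl (X : psset) : pmap point X := @PMap point X (yoneda (pt X)) _.
Next Obligation. by move=> X /=; rewrite act_id. Qed.

Definition hofib (X Z : psset) (c : pmap X Z) : psset := phpb c (point_incl Z).

Program Definition hofib_proj (X Z : psset) (c : pmap X Z) : pmap (hofib c) X :=
  @PMap (hofib c) X (@SMap (hofib c) X (fun n u => hpb_fst u) _) _.
Next Obligation. by []. Qed.
Next Obligation. by []. Qed.

Definition Loop (Z : psset) : psset := hofib (point_incl Z).

Program Definition loop_to_hofib_simplex (X Z : psset) (c : pmap X Z) n
    (u : Loop Z n) : hofib c n :=
  @HpbSimplex X point Z c (point_incl Z) n (ptn X n) (hpb_snd u) (hpb_path u) _.
Next Obligation.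
move=> X Z c n u m t; have [-> ->] := hpb_ends u t; split=> //.
rewrite /ptn smap_nat pmap_pt /=; congr (act t (act _ (pt Z))).
by apply: mono_eq => i; rewrite [LHS]ord1.
Qed.

Program Definition loop_to_hofib (X Z : psset) (c : pmap X Z) :
    pmap (Loop Z) (hofib c) :=
  @PMap (Loop Z) (hofib c)
    (@SMap (Loop Z) (hofib c) (@loop_to_hofib_simplex X Z c) _) _.
Next Obligation.
by move=> X Z c m n t u; apply: hpb_eq => //=; rewrite /ptn -act_comp.
Qed.
Next Obligation.
by move=> X Z c; apply: hpb_eq => //=; rewrite /ptn -[RHS]act_id; congr act;
  apply: mono_eq => i; rewrite [RHS]ord1.
Qed.

(* The abelian group [A], multiplicative in the source, is a [zmodType] here:
   products of elements of [A] become sums. *)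

(* A simplex is degenerate iff it is [act t y] for a non-injective [t]. *)
Definition normalized (A : zmodType) (X : sset) n (z : X n -> A) : Prop :=
  forall m (t : mono n m) (y : X m), ~ injective t -> z (act t y) = 0%R.

Definition coboundary (A : zmodType) (X : sset) n (z : X n -> A) (x : X n.+1) : A :=
  (\sum_(i < n.+2) z (act (coface i) x) *~ (-1) ^+ i)%R.

Record cocycle (A : zmodType) (X : sset) n := Cocycle {
  cocycle_fun :> X n -> A;
  cocycle_norm : normalized cocycle_fun;
  cocycle_closed : forall x, coboundary cocycle_fun x = 0%R }.

Lemma cocycle_eq (A : zmodType) (X : sset) n (z w : cocycle A X n) : z =1 w -> z = w.
Proof.
case: z w => [z p q] [w p' q'] /= /functional_extensionality ezw.
case: w / ezw p' q' => p' q'.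
by rewrite (proof_irrelevance _ p p') (proof_irrelevance _ q q').
Qed.

Program Definition cocycle_pullback (A : zmodType) (X Y : sset) n (f : smap X Y)
    (z : cocycle A Y n) : cocycle A X n :=
  @Cocycle A X n (fun x => z (f n x)) _ _.
Next Obligation.
by move=> A X Y n f z m t y tP; rewrite smap_nat; apply: cocycle_norm.
Qed.
Next Obligation.
move=> A X Y n f z x; rewrite -[RHS](cocycle_closed z (f _ x)).
by apply: eq_bigr => i _; rewrite smap_nat.
Qed.

(* The simplicial set underlying the Dold-Kan image of [A] placed in degree
   [n]: its [m]-simplices are the chain maps from the normalized chains of
   [Delta m] to [A] in degree [n], i.e. the normalized cocycles. *)
Program Definition EM_sset (A : zmodType) n : sset :=
  @SSet (fun m => cocycle A (Delta m) n)
    (fun l m t z => cocycle_pullback (Delta_map t) z) _ _.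
Next Obligation.
by move=> A n m z; apply: cocycle_eq => -[f p] /=; congr (z _); apply: mono_eq.
Qed.
Next Obligation. by move=> A n k l m t s z; apply: cocycle_eq. Qed.

Program Definition zero_cocycle (A : zmodType) (X : sset) n : cocycle A X n :=
  @Cocycle A X n (fun _ => 0%R) _ _.
Next Obligation. by []. Qed.
Next Obligation.
by move=> A X n x; rewrite /coboundary big1 // => i _; rewrite mul0rz.
Qed.

Definition EM (A : zmodType) n : psset := @PSSet (EM_sset A n) (zero_cocycle A (Delta 0) n).

Program Definition classifying_smap (A : zmodType) (X : sset) n (z : cocycle A X n) :
    smap X (EM_sset A n) :=
  @SMap X (EM_sset A n) (fun m x => cocycle_pullback (yoneda x) z) _.
Next Obligation.
by move=> A X n z l m t x; apply: cocycle_eq => s /=; rewrite -act_comp.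
Qed.

Lemma mono0_ninj n (t : mono n.+1 0) : ~ injective t.
Proof. by move=> /(_ ord0 ord_max); rewrite !ord1 => /(_ erefl) /(congr1 val). Qed.

Program Definition classifying_map (A : zmodType) (X : psset) n
    (z : cocycle A X n.+1) : pmap X (EM A n.+1) :=
  @PMap X (EM A n.+1) (classifying_smap z) _.
Next Obligation.
by move=> A X n z; apply: cocycle_eq => t /=; apply: cocycle_norm (@mono0_ninj n t).
Qed.

(* Compositions are written in diagrammatic order: [hcomp f g] is [f] followed
   by [g], and [vcomp a b] is [a] followed by [b]. *)
Record bicategory := Bicategory {
  ob :> Type;
  mor : ob -> ob -> Type;
  cell : forall x y, mor x y -> mor x y -> Type;
  cid : forall x y (f : mor x y), cell f f;
  vcomp : forall x y (f g h : mor x y), cell f g -> cell g h -> cell f h;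
  one : forall x, mor x x;
  hcomp : forall x y z, mor x y -> mor y z -> mor x z;
  hcell : forall x y z (f f' : mor x y) (g g' : mor y z),
    cell f f' -> cell g g' -> cell (hcomp f g) (hcomp f' g');
  assoc : forall x y z w (f : mor x y) (g : mor y z) (h : mor z w),
    cell (hcomp (hcomp f g) h) (hcomp f (hcomp g h));
  lunit : forall x y (f : mor x y), cell (hcomp (one x) f) f;
  runit : forall x y (f : mor x y), cell (hcomp f (one y)) f;
  vcomp1c : forall x y (f g : mor x y) (a : cell f g), vcomp (cid f) a = a;
  vcompc1 : forall x y (f g : mor x y) (a : cell f g), vcomp a (cid g) = a;
  vcompA : forall x y (f g h k : mor x y) (a : cell f g) (b : cell g h) (c : cell h k),
    vcomp a (vcomp b c) = vcomp (vcomp a b) c;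
  hcell1 : forall x y z (f : mor x y) (g : mor y z),
    hcell (cid f) (cid g) = cid (hcomp f g);
  hcellM : forall x y z (f f' f'' : mor x y) (g g' g'' : mor y z)
      (a : cell f f') (a' : cell f' f'') (b : cell g g') (b' : cell g' g''),
    hcell (vcomp a a') (vcomp b b') = vcomp (hcell a b) (hcell a' b');
  assoc_inv : forall x y z w (f : mor x y) (g : mor y z) (h : mor z w),
    exists a, vcomp (assoc f g h) a = cid _ /\ vcomp a (assoc f g h) = cid _;
  lunit_inv : forall x y (f : mor x y),
    exists a, vcomp (lunit f) a = cid _ /\ vcomp a (lunit f) = cid _;
  runit_inv : forall x y (f : mor x y),
    exists a, vcomp (runit f) a = cid _ /\ vcomp a (runit f) = cid _;
  assoc_nat : forall x y z w (f f' : mor x y) (g g' : mor y z) (h h' : mor z w)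
      (a : cell f f') (b : cell g g') (c : cell h h'),
    vcomp (hcell (hcell a b) c) (assoc f' g' h') =
    vcomp (assoc f g h) (hcell a (hcell b c));
  lunit_nat : forall x y (f g : mor x y) (a : cell f g),
    vcomp (hcell (cid (one x)) a) (lunit g) = vcomp (lunit f) a;
  runit_nat : forall x y (f g : mor x y) (a : cell f g),
    vcomp (hcell a (cid (one y))) (runit g) = vcomp (runit f) a;
  pentagon : forall x y z w v (f : mor x y) (g : mor y z) (h : mor z w) (k : mor w v),
    vcomp (hcell (assoc f g h) (cid k))
          (vcomp (assoc f (hcomp g h) k) (hcell (cid f) (assoc g h k))) =
    vcomp (assoc (hcomp f g) h k) (assoc f g (hcomp h k));
  triangle : forall x y z (f : mor x y) (g : mor y z),
    vcomp (assoc f (one y) g) (hcell (cid f) (lunit g)) = hcell (runit f) (cid g);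
  lunit_one : forall x, lunit (one x) = runit (one x) }.

Definition eq_cell (B : bicategory) (x y : B) (f g : mor x y) (e : f = g) : cell f g :=
  match e in _ = h return cell f h with erefl => cid f end.

(* Since every hom-category of the ordinal [n] is a point or empty, its action
   on 2-cells and the naturality of [comp2] carry no information. *)
Record lax_axioms (B : bicategory) n (F0 : 'I_n.+1 -> B)
    (F1 : forall i j : 'I_n.+1, i <= j -> mor (F0 i) (F0 j))
    (comp2 : forall (i j k : 'I_n.+1) (p : i <= j) (q : j <= k) (r : i <= k),
       cell (hcomp (F1 i j p) (F1 j k q)) (F1 i k r)) : Prop := LaxAxioms {
  lax_one : forall (i : 'I_n.+1) (p : i <= i), F1 i i p = one (F0 i);
  lax_lunit : forall (i j : 'I_n.+1) (p : i <= i) (q : i <= j),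
    vcomp (hcell (eq_cell (esym (lax_one p))) (cid (F1 i j q))) (comp2 i i j p q q)
    = lunit (F1 i j q);
  lax_runit : forall (i j : 'I_n.+1) (p : j <= j) (q : i <= j),
    vcomp (hcell (cid (F1 i j q)) (eq_cell (esym (lax_one p)))) (comp2 i j j q p q)
    = runit (F1 i j q);
  lax_assoc : forall (i j k l : 'I_n.+1) (p : i <= j) (q : j <= k) (r : k <= l)
      (pq : i <= k) (qr : j <= l) (pqr : i <= l),
    vcomp (hcell (comp2 i j k p q pq) (cid (F1 k l r))) (comp2 i k l pq r pqr) =
    vcomp (assoc (F1 i j p) (F1 j k q) (F1 k l r))
          (vcomp (hcell (cid (F1 i j p)) (comp2 j k l q r qr)) (comp2 i j l p qr pqr)) }.

(* Strictly unitary lax functors from [{0 < ... < n}] to [B]. *)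
Record lax (B : bicategory) n := Lax {
  lax0 : 'I_n.+1 -> B;
  lax1 : forall i j : 'I_n.+1, i <= j -> mor (lax0 i) (lax0 j);
  lax2 : forall (i j k : 'I_n.+1) (p : i <= j) (q : j <= k) (r : i <= k),
    cell (hcomp (lax1 p) (lax1 q)) (lax1 r);
  lax_ax : lax_axioms lax2 }.

Program Definition lax_act (B : bicategory) m n (t : mono m n) (F : lax B n) : lax B m :=
  @Lax B m (fun i => lax0 F (t i)) (fun i j p => lax1 F (mono_le t p))
    (fun i j k p q r => lax2 F (mono_le t p) (mono_le t q) (mono_le t r)) _.
Next Obligation.
move=> B m n t [F0 F1 F2 [F1_1 F1l F1r FA]] /=.
by exists (fun i p => F1_1 (t i) (mono_le t p)) => *; [apply: F1l | apply: F1r | apply: FA].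
Qed.

Lemma lax_eq_ax (B : bicategory) n F0 F1 F2 ax ax' :
  @Lax B n F0 F1 F2 ax = @Lax B n F0 F1 F2 ax'.
Proof. by rewrite (proof_irrelevance _ ax ax'). Qed.

Program Definition Duskin (B : bicategory) : sset := @SSet (lax B) (@lax_act B) _ _.
Next Obligation. by move=> B n [*]; apply: lax_eq_ax. Qed.
Next Obligation. by move=> B l m n t s [*]; apply: lax_eq_ax. Qed.

Program Definition lax_vertex (B : bicategory) (x : B) : lax B 0 :=
  @Lax B 0 (fun _ => x) (fun _ _ _ => one x) (fun _ _ _ _ _ _ => lunit (one x)) _.
Next Obligation.
move=> B x; exists (fun _ _ => erefl) => /= [i j _ _|i j _ _|i j k l *].
- by rewrite hcell1 vcomp1c.
- by rewrite hcell1 vcomp1c lunit_one.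
- by rewrite vcompA triangle lunit_one.
Qed.

(* Pseudofunctors that preserve identity 1-morphisms on the nose. *)
Record sufunctor (B C : bicategory) := SUFunctor {
  fun0 : B -> C;
  fun1 : forall x y : B, mor x y -> mor (fun0 x) (fun0 y);
  fun2 : forall (x y : B) (f g : mor x y), cell f g -> cell (fun1 f) (fun1 g);
  funM : forall (x y z : B) (f : mor x y) (g : mor y z),
    cell (hcomp (fun1 f) (fun1 g)) (fun1 (hcomp f g));
  fun_one : forall x : B, fun1 (one x) = one (fun0 x);
  fun2_id : forall (x y : B) (f : mor x y), fun2 (cid f) = cid (fun1 f);
  fun2_vcomp : forall (x y : B) (f g h : mor x y) (a : cell f g) (b : cell g h),
    fun2 (vcomp a b) = vcomp (fun2 a) (fun2 b);
  funM_inv : forall (x y z : B) (f : mor x y) (g : mor y z),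
    exists a, vcomp (funM f g) a = cid _ /\ vcomp a (funM f g) = cid _;
  funM_nat : forall (x y z : B) (f f' : mor x y) (g g' : mor y z)
      (a : cell f f') (b : cell g g'),
    vcomp (hcell (fun2 a) (fun2 b)) (funM f' g') = vcomp (funM f g) (fun2 (hcell a b));
  fun_lunit : forall (x y : B) (f : mor x y),
    vcomp (hcell (eq_cell (esym (fun_one x))) (cid (fun1 f)))
          (vcomp (funM (one x) f) (fun2 (lunit f))) = lunit (fun1 f);
  fun_runit : forall (x y : B) (f : mor x y),
    vcomp (hcell (cid (fun1 f)) (eq_cell (esym (fun_one y))))
          (vcomp (funM f (one y)) (fun2 (runit f))) = runit (fun1 f);
  fun_assoc : forall (x y z w : B) (f : mor x y) (g : mor y z) (h : mor z w),
    vcomp (hcell (funM f g) (cid (fun1 h)))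
          (vcomp (funM (hcomp f g) h) (fun2 (assoc f g h))) =
    vcomp (assoc (fun1 f) (fun1 g) (fun1 h))
          (vcomp (hcell (cid (fun1 f)) (funM g h)) (funM f (hcomp g h))) }.

Lemma eq_cell_comp (B : bicategory) (x y : B) (f g h : mor x y) (e : g = f) (e' : g = h)
    (e'' : f = h) : vcomp (eq_cell e) (eq_cell e'') = eq_cell e'.
Proof.
case: h / e'' e' => e'; rewrite (proof_irrelevance _ e' e).
by case: f / e {e'}; rewrite vcomp1c.
Qed.

Lemma fun2_eq_cell (B C : bicategory) (P : sufunctor B C) (x y : B) (f g : mor x y)
    (e : f = g) (e' : fun1 P f = fun1 P g) : fun2 P (eq_cell e) = eq_cell e'.
Proof.
by case: g / e e' => e'; rewrite (proof_irrelevance _ e' erefl) /= fun2_id.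
Qed.

Program Definition lax_post (B C : bicategory) (P : sufunctor B C) n (F : lax B n) :
    lax C n :=
  @Lax C n (fun i => fun0 P (lax0 F i)) (fun i j p => fun1 P (lax1 F p))
    (fun i j k p q r => vcomp (funM P (lax1 F p) (lax1 F q)) (fun2 P (lax2 F p q r))) _.
Next Obligation.
move=> B C P n [F0 F1 F2 [F1_1 F1l F1r FA]] /=.
exists (fun i p => etrans (congr1 (@fun1 _ _ P _ _) (F1_1 i p)) (fun_one P (F0 i)))
  => [i j p q|i j p q|i j k l p q r pq qr pqr].
- have e : one (fun0 P (F0 i)) = fun1 P (F1 i i p) by rewrite F1_1 fun_one.
  have e1 : fun1 P (one (F0 i)) = fun1 P (F1 i i p) by rewrite F1_1.
  rewrite -(fun_lunit P) -(F1l i j p q) fun2_vcomp (vcompA (funM _ _ _)) -funM_nat.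
  rewrite fun2_id !vcompA -hcellM vcompc1 (fun2_eq_cell _ e1).
  by rewrite (eq_cell_comp _ e); do ![congr vcomp]; congr hcell; congr eq_cell;
     apply: proof_irrelevance.
- have e : one (fun0 P (F0 j)) = fun1 P (F1 j j p) by rewrite F1_1 fun_one.
  have e1 : fun1 P (one (F0 j)) = fun1 P (F1 j j p) by rewrite F1_1.
  rewrite -(fun_runit P) -(F1r i j p q) fun2_vcomp (vcompA (funM _ _ _)) -funM_nat.
  rewrite fun2_id !vcompA -hcellM vcompc1 (fun2_eq_cell _ e1).
  by rewrite (eq_cell_comp _ e); do ![congr vcomp]; congr hcell; congr eq_cell;
     apply: proof_irrelevance.
- rewrite -[cid (fun1 P (F1 k l r))]vcomp1c -[cid (fun1 P (F1 i j p))]vcomp1c !hcellM.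
  rewrite -!fun2_id -!vcompA (vcompA (hcell (fun2 _ _) _)) funM_nat.
  rewrite (vcompA (hcell (fun2 _ (cid (F1 i j p))) (fun2 _ _))) funM_nat -!vcompA.
  rewrite -!fun2_vcomp (FA i j k l p q r pq qr pqr) fun2_vcomp.
  by rewrite fun2_id !vcompA; congr vcomp; rewrite -!vcompA fun2_id fun_assoc.
Qed.

Program Definition Duskin_map (B C : bicategory) (P : sufunctor B C) :
    smap (Duskin B) (Duskin C) := @SMap (Duskin B) (Duskin C) (@lax_post B C P) _.
Next Obligation. by move=> *; apply: lax_eq_ax. Qed.

Lemma lax_eq (B : bicategory) n F0
    (F1 F1' : forall i j : 'I_n.+1, i <= j -> mor (F0 i) (F0 j)) F2 F2' ax ax'
    (e : forall i j p, F1 i j p = F1' i j p) :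
  (forall (i j k : 'I_n.+1) p q r,
     vcomp (F2 i j k p q r) (eq_cell (e i k r)) =
     vcomp (hcell (eq_cell (e i j p)) (eq_cell (e j k q))) (F2' i j k p q r)) ->
  @Lax B n F0 F1 F2 ax = @Lax B n F0 F1' F2' ax'.
Proof.
have eF : F1 = F1' by do 3![apply: functional_extensionality_dep => ?]; apply: e.
case: F1' / eF F2' ax' e => F2' ax' e e2.
have eF : F2 = F2'.
  apply: functional_extensionality_dep => i; apply: functional_extensionality_dep => j.
  apply: functional_extensionality_dep => k; apply: functional_extensionality_dep => p.
  apply: functional_extensionality_dep => q; apply: functional_extensionality_dep => r.
  move: (e2 i j k p q r).
  rewrite !(proof_irrelevance _ (e _ _ _) erefl) /=.
  by rewrite vcompc1 hcell1 vcomp1c.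
by case: F2' / eF {e2} ax' => ax'; apply: lax_eq_ax.
Qed.

Lemma lax_post_vertex (B C : bicategory) (P : sufunctor B C) (x : B) :
  lax_post P (lax_vertex x) = lax_vertex (fun0 P x).
Proof.
apply: (lax_eq _ _ (e := fun _ _ _ => fun_one P x)) => /= _ _ _ _ _ _.
set e := fun_one P x; set M := vcomp (funM _ _ _) _.
have -> : M = vcomp (hcell (eq_cell e) (cid _)) (lunit (fun1 P (one x))).
  rewrite -(fun_lunit P) -/M vcompA -hcellM vcompc1.
  by rewrite (eq_cell_comp e erefl) /= hcell1 vcomp1c.
by rewrite -vcompA -lunit_nat vcompA -hcellM vcomp1c vcompc1.
Qed.

(* Composition is again in diagrammatic order. *)
Record moncat := MonCat {
  obj :> Type;
  hom : obj -> obj -> Type;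
  mid : forall x, hom x x;
  mcomp : forall x y z, hom x y -> hom y z -> hom x z;
  munit : obj;
  tens : obj -> obj -> obj;
  tensh : forall x x' y y', hom x x' -> hom y y' -> hom (tens x y) (tens x' y');
  massoc : forall x y z, hom (tens (tens x y) z) (tens x (tens y z));
  mlunit : forall x, hom (tens munit x) x;
  mrunit : forall x, hom (tens x munit) x;
  mcomp1h : forall x y (a : hom x y), mcomp (mid x) a = a;
  mcomph1 : forall x y (a : hom x y), mcomp a (mid y) = a;
  mcompA : forall x y z w (a : hom x y) (b : hom y z) (c : hom z w),
    mcomp a (mcomp b c) = mcomp (mcomp a b) c;
  tensh1 : forall x y, tensh (mid x) (mid y) = mid (tens x y);
  tenshM : forall x x' x'' y y' y'' (a : hom x x') (a' : hom x' x'')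
      (b : hom y y') (b' : hom y' y''),
    tensh (mcomp a a') (mcomp b b') = mcomp (tensh a b) (tensh a' b');
  massoc_inv : forall x y z,
    exists a, mcomp (massoc x y z) a = mid _ /\ mcomp a (massoc x y z) = mid _;
  mlunit_inv : forall x, exists a, mcomp (mlunit x) a = mid _ /\ mcomp a (mlunit x) = mid _;
  mrunit_inv : forall x, exists a, mcomp (mrunit x) a = mid _ /\ mcomp a (mrunit x) = mid _;
  massoc_nat : forall x x' y y' z z' (a : hom x x') (b : hom y y') (c : hom z z'),
    mcomp (tensh (tensh a b) c) (massoc x' y' z') =
    mcomp (massoc x y z) (tensh a (tensh b c));
  mlunit_nat : forall x y (a : hom x y),
    mcomp (tensh (mid munit) a) (mlunit y) = mcomp (mlunit x) a;
  mrunit_nat : forall x y (a : hom x y),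
    mcomp (tensh a (mid munit)) (mrunit y) = mcomp (mrunit x) a;
  mpentagon : forall x y z w,
    mcomp (tensh (massoc x y z) (mid w))
          (mcomp (massoc x (tens y z) w) (tensh (mid x) (massoc y z w))) =
    mcomp (massoc (tens x y) z w) (massoc x y (tens z w));
  mtriangle : forall x y,
    mcomp (massoc x munit y) (tensh (mid x) (mlunit y)) = tensh (mrunit x) (mid y);
  mlunit_unit : mlunit munit = mrunit munit }.

Record twogroup := TwoGroup {
  tg_moncat :> moncat;
  hom_inv : forall (x y : tg_moncat) (a : hom x y),
    exists b, mcomp a b = mid _ /\ mcomp b a = mid _;
  weak_inv : forall x : tg_moncat, exists (y : tg_moncat) (a : hom (tens x y) (munit _)) b,
    mcomp a b = mid _ /\ mcomp b a = mid _ }.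

Definition deloop (M : moncat) : bicategory :=
  @Bicategory unit (fun _ _ => obj M) (fun _ _ => @hom M)
    (fun _ _ => @mid M) (fun _ _ => @mcomp M) (fun _ => munit M)
    (fun _ _ _ => @tens M) (fun _ _ _ => @tensh M)
    (fun _ _ _ _ => @massoc M) (fun _ _ => @mlunit M) (fun _ _ => @mrunit M)
    (fun _ _ => @mcomp1h M) (fun _ _ => @mcomph1 M) (fun _ _ => @mcompA M)
    (fun _ _ _ => @tensh1 M) (fun _ _ _ => @tenshM M)
    (fun _ _ _ _ => @massoc_inv M) (fun _ _ => @mlunit_inv M) (fun _ _ => @mrunit_inv M)
    (fun _ _ _ _ => @massoc_nat M) (fun _ _ => @mlunit_nat M) (fun _ _ => @mrunit_nat M)
    (fun _ _ _ _ _ => @mpentagon M) (fun _ _ _ => @mtriangle M) (fun _ => mlunit_unit M).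

(* Between one-object bicategories, strictly unitary pseudofunctors are the
   same data as strictly unitary (strong) monoidal functors. *)
Definition monfun (M N : moncat) := sufunctor (deloop M) (deloop N).

Definition BTwoGroup (M : twogroup) : psset :=
  @PSSet (Duskin (deloop M)) (lax_vertex (B := deloop M) tt).

Program Definition Bmonfun (M N : twogroup) (P : monfun M N) :
    pmap (BTwoGroup M) (BTwoGroup N) :=
  @PMap (BTwoGroup M) (BTwoGroup N) (Duskin_map P) _.
Next Obligation. by move=> M N P; rewrite /= lax_post_vertex; case: (fun0 P tt). Qed.

Program Definition discrete_moncat (G : groupType) : moncat :=
  @MonCat G (fun g h => g = h) (@erefl G) (@etrans G) 1%g (fun g h => (g * h)%g)
    (fun g g' h h' p q => f_equal2 (fun g h => (g * h)%g) p q)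
    (fun f g h => esym (mulgA f g h)) (@mul1g G) (@mulg1 G)
    _ _ _ _ _ _ _ _ _ _ _ _ _ _.
Solve Obligations with try (move=> *; exact: proof_irrelevance).
Next Obligation.
by move=> G f g h; exists (mulgA f g h); split; apply: proof_irrelevance.
Qed.
Next Obligation.
by move=> G g; exists (esym (mul1g g)); split; apply: proof_irrelevance.
Qed.
Next Obligation.
by move=> G g; exists (esym (mulg1 g)); split; apply: proof_irrelevance.
Qed.

Program Definition discrete_twogroup (G : groupType) : twogroup :=
  @TwoGroup (discrete_moncat G) _ _.
Next Obligation. by move=> G g h p; exists (esym p); split=> /=; apply: proof_irrelevance. Qed.
Next Obligation.
move=> G g; exists (g^-1)%g, (mulgV g), (esym (mulgV g)).
by split=> /=; apply: proof_irrelevance.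
Qed.

Section SkeletalExtension.
Local Open Scope ring_scope.

Program Definition oneobj_moncat (A : zmodType) : moncat :=
  @MonCat unit (fun _ _ => A) (fun _ => 0) (fun _ _ _ a b => a + b) tt (fun _ _ => tt)
    (fun _ _ _ _ a b => a + b) (fun _ _ _ => 0) (fun _ => 0) (fun _ => 0)
    _ _ _ _ _ _ _ _ _ _ _ _ _ _.
Next Obligation. by move=> * /=; rewrite add0r. Qed.
Next Obligation. by move=> * /=; rewrite addr0. Qed.
Next Obligation. by move=> * /=; rewrite addrA. Qed.
Next Obligation. by move=> * /=; rewrite addr0. Qed.
Next Obligation. by move=> * /=; rewrite addrACA. Qed.
Next Obligation. by move=> A *; exists 0; rewrite /= addr0. Qed.
Next Obligation. by move=> A *; exists 0; rewrite /= addr0. Qed.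
Next Obligation. by move=> A *; exists 0; rewrite /= addr0. Qed.
Next Obligation. by move=> * /=; rewrite addr0 add0r addrA. Qed.
Next Obligation. by move=> * /=; rewrite addr0. Qed.
Next Obligation. by move=> * /=; rewrite !addr0 add0r. Qed.
Next Obligation. by move=> * /=; rewrite !addr0. Qed.
Next Obligation. by move=> * /=; rewrite !addr0. Qed.
Next Obligation. by []. Qed.

Program Definition oneobj_twogroup (A : zmodType) : twogroup :=
  @TwoGroup (oneobj_moncat A) _ _.
Next Obligation. by move=> A x y a; exists (- a); rewrite /= subrr addNr. Qed.
Next Obligation. by move=> A x; exists tt, 0, 0; rewrite /= addr0. Qed.

Definition normalized_3cocycle (G : groupType) (A : zmodType) (alpha : G -> G -> G -> A) :
    Prop :=
  (forall f g h k,
     alpha g h k + alpha f (g * h)%g k + alpha f g h =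
     alpha (f * g)%g h k + alpha f g (h * k)%g) /\
  (forall g h k, g = 1%g \/ h = 1%g \/ k = 1%g -> alpha g h k = 0).

Section SkeletalTwoGroup.
Variables (G : groupType) (A : zmodType) (alpha : G -> G -> G -> A).
Hypothesis alphaP : normalized_3cocycle alpha.

(* A copy of [A] if [g = h], and empty otherwise. *)
Definition skel_hom (g h : G) := {a : A | g = h}.

Lemma skel_eq g h (a b : skel_hom g h) : sval a = sval b -> a = b.
Proof.
case: a b => [a p] [b q] /= eab; case: b / eab.
by rewrite (proof_irrelevance _ p q).
Qed.

Program Definition skel_moncat : moncat :=
  @MonCat G skel_hom (fun g => exist _ 0 erefl)
    (fun g h k a b => exist _ (sval a + sval b) (etrans (svalP a) (svalP b)))
    1%g (fun g h => (g * h)%g)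
    (fun g g' h h' a b => exist _ (sval a + sval b)
       (f_equal2 (fun g h => (g * h)%g) (svalP a) (svalP b)))
    (fun f g h => exist _ (alpha f g h) (esym (mulgA f g h)))
    (fun g => exist _ 0 (mul1g g)) (fun g => exist _ 0 (mulg1 g))
    _ _ _ _ _ _ _ _ _ _ _ _ _ _.
Next Obligation. by move=> g h a; apply: skel_eq; rewrite /= add0r. Qed.
Next Obligation. by move=> g h a; apply: skel_eq; rewrite /= addr0. Qed.
Next Obligation. by move=> g h k l a b c; apply: skel_eq; rewrite /= addrA. Qed.
Next Obligation. by move=> g h; apply: skel_eq; rewrite /= addr0. Qed.
Next Obligation. by move=> *; apply: skel_eq; rewrite /= addrACA. Qed.
Next Obligation.
move=> f g h; exists (exist _ (- alpha f g h) (mulgA f g h)).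
by split; apply: skel_eq; rewrite /= ?subrr ?addNr.
Qed.
Next Obligation.
move=> g; exists (exist _ 0 (esym (mul1g g))).
by split; apply: skel_eq; rewrite /= addr0.
Qed.
Next Obligation.
move=> g; exists (exist _ 0 (esym (mulg1 g))).
by split; apply: skel_eq; rewrite /= addr0.
Qed.
Next Obligation.
move=> f f' g g' h h' [a p] [b q] [c r]; apply: skel_eq; rewrite /= addrC -addrA.
by case: f' / p; case: g' / q; case: h' / r.
Qed.
Next Obligation. by move=> g h a; apply: skel_eq; rewrite /= addr0. Qed.
Next Obligation. by move=> g h a; apply: skel_eq; rewrite /= !addr0 add0r. Qed.
Next Obligation.
move=> f g h k; apply: skel_eq; rewrite /= addr0 add0r -(proj1 alphaP).
by rewrite addrC (addrC (alpha g h k)).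
Qed.
Next Obligation.
move=> f g; apply: skel_eq; rewrite /= !addr0.
by apply: (proj2 alphaP); right; left.
Qed.
Next Obligation. by apply: skel_eq. Qed.

Program Definition skel_twogroup : twogroup := @TwoGroup skel_moncat _ _.
Next Obligation.
move=> g h a; exists (exist _ (- sval a) (esym (svalP a))).
by split; apply: skel_eq; rewrite /= ?subrr ?addNr.
Qed.
Next Obligation.
move=> g; exists (g^-1)%g, (exist _ 0 (mulgV g)), (exist _ 0 (esym (mulgV g))).
by split; apply: skel_eq; rewrite /= addr0.
Qed.

Program Definition skel_incl : monfun (oneobj_twogroup A) skel_twogroup :=
  @SUFunctor (deloop (oneobj_moncat A)) (deloop skel_moncat) id (fun _ _ _ => 1%g)
    (fun _ _ _ _ a => exist _ a erefl)
    (fun _ _ _ _ _ => exist _ 0 (mulg1 1%g)) (fun _ => erefl)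
    _ _ _ _ _ _ _.
Next Obligation. by move=> *; apply: skel_eq. Qed.
Next Obligation. by move=> *; apply: skel_eq. Qed.
Next Obligation.
move=> *; exists (exist _ 0 (esym (mulg1 1%g))).
by split; apply: skel_eq; rewrite /= addr0.
Qed.
Next Obligation. by move=> *; apply: skel_eq; rewrite /= !addr0 add0r. Qed.
Next Obligation. by move=> *; apply: skel_eq; rewrite /= !addr0. Qed.
Next Obligation. by move=> *; apply: skel_eq; rewrite /= !addr0. Qed.
Next Obligation.
move=> *; apply: skel_eq; rewrite /= !addr0.
by rewrite (proj2 alphaP) //; left.
Qed.

Program Definition skel_proj : monfun skel_twogroup (discrete_twogroup G) :=
  @SUFunctor (deloop skel_moncat) (deloop (discrete_moncat G)) id (fun _ _ g => g)
    (fun _ _ _ _ a => svalP a) (fun _ _ _ _ _ => erefl) (fun _ => erefl)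
    _ _ _ _ _ _ _.
Next Obligation. by move=> * /=; apply: proof_irrelevance. Qed.
Next Obligation. by move=> * /=; apply: proof_irrelevance. Qed.
Next Obligation. by move=> *; exists erefl; split=> /=; apply: proof_irrelevance. Qed.
Next Obligation. by move=> * /=; apply: proof_irrelevance. Qed.
Next Obligation. by move=> * /=; apply: proof_irrelevance. Qed.
Next Obligation. by move=> * /=; apply: proof_irrelevance. Qed.
Next Obligation. by move=> * /=; apply: proof_irrelevance. Qed.

Definition skel_extension :
    extension (BTwoGroup (oneobj_twogroup A)) (BTwoGroup (discrete_twogroup G)) :=
  Extension (Bmonfun skel_incl) (Bmonfun skel_proj).
End SkeletalTwoGroup.
End SkeletalExtension.

Lemma mono_ninj m n (t : mono m n) :
  ~ injective t -> exists i j : 'I_m.+1, j = i.+1 :> nat /\ t i = t j.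
Proof.
move=> tN; case: (boolP [exists i : 'I_m.+1, exists j : 'I_m.+1,
    (j == i.+1 :> nat) && (t i == t j)]).
  by case/existsP=> i /existsP[j /andP[/eqP eij /eqP etij]]; exists i, j.
move=> /existsPn nt; case: tN.
have t_lt (i j : 'I_m.+1) : i < j -> t i < t j.
  move=> lt_ij; have lt_i : i.+1 < m.+1 by apply: leq_trans lt_ij (ltn_ord j).
  have le_ti : t i <= t (Ordinal lt_i) by apply: mono_le => /=.
  have : t i != t (Ordinal lt_i) by move/existsPn: (nt i) => /(_ (Ordinal lt_i)); rewrite eqxx.
  rewrite -val_eqE /= => ne; apply: (@leq_trans (t (Ordinal lt_i))); last exact: mono_le.
  by rewrite ltn_neqAle ne.
move=> i j eij; apply: val_inj; case: (ltngtP i j) => // lt_ij;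
  by have := t_lt _ _ lt_ij; rewrite eij ltnn.
Qed.

Section Nerves.
Local Open Scope ring_scope.

Lemma alternating_sum4 (A : zmodType) (f : 'I_4 -> A) :
  \sum_(i < 4) f i *~ (-1) ^+ i =
  f (@Ordinal 4 0 isT) - f (@Ordinal 4 1 isT) + f (@Ordinal 4 2 isT)
  - f (@Ordinal 4 3 isT).
Proof.
have e : ((-1) ^+ 2 = 1 :> int) * ((-1) ^+ 3 = -1 :> int) * ((-1) ^+ 4 = 1 :> int) by [].
rewrite !big_ord_recr big_ord0 /= !e expr0 expr1 !mulr1z !mulrN1z add0r.
by do ![congr (_ + _)]; try congr (- _); congr f; apply: val_inj.
Qed.

Lemma alternating_sum5 (A : zmodType) (f : 'I_5 -> A) :
  \sum_(i < 5) f i *~ (-1) ^+ i =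
  f (@Ordinal 5 0 isT) - f (@Ordinal 5 1 isT) + f (@Ordinal 5 2 isT)
  - f (@Ordinal 5 3 isT) + f (@Ordinal 5 4 isT).
Proof.
have e : ((-1) ^+ 2 = 1 :> int) * ((-1) ^+ 3 = -1 :> int) * ((-1) ^+ 4 = 1 :> int) by [].
rewrite !big_ord_recr big_ord0 /= !e expr0 expr1 !mulr1z !mulrN1z add0r.
by do ![congr (_ + _)]; try congr (- _); congr f; apply: val_inj.
Qed.

Lemma nerve_lax1 (G : groupType) n (x : Duskin (deloop (discrete_moncat G)) n)
    (i j i' j' : 'I_n.+1) (p : (i <= j)%N) (q : (i' <= j')%N) :
  i = i' :> nat -> j = j' :> nat -> lax1 x p = lax1 x q.
Proof.
by move=> /val_inj ei /val_inj ej; case: i' / ei q; case: j' / ej => q;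
  rewrite (bool_irrelevance p q).
Qed.

Lemma nerve_lax1_eq (G : groupType) n (x : Duskin (deloop (discrete_moncat G)) n)
    (i j : 'I_n.+1) (p : (i <= j)%N) : i = j -> lax1 x p = 1%g.
Proof. by move=> eij; case: j / eij p => p; rewrite (lax_one (lax_ax x)). Qed.

Definition nerve_cochain (G : groupType) (A : zmodType) (alpha : G -> G -> G -> A)
    (x : Duskin (deloop (discrete_moncat G)) 3) : A :=
  alpha (@lax1 _ 3 x (@Ordinal 4 0 isT) (@Ordinal 4 1 isT) isT)
        (@lax1 _ 3 x (@Ordinal 4 1 isT) (@Ordinal 4 2 isT) isT)
        (@lax1 _ 3 x (@Ordinal 4 2 isT) (@Ordinal 4 3 isT) isT).

Program Definition nerve_cocycle (G : groupType) (A : zmodType)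
    (alpha : G -> G -> G -> A) (alphaP : normalized_3cocycle alpha) :
    cocycle A (BTwoGroup (discrete_twogroup G)) 3 :=
  @Cocycle A (BTwoGroup (discrete_twogroup G)) 3 (nerve_cochain alpha) _ _.
Next Obligation.
move=> G A alpha [_ alpha1] m t y /mono_ninj[i [j [eij etij]]].
apply: alpha1; case: i j => [i lti] [j ltj] /= in eij etij *; subst j.
by case: i lti ltj etij => [|[|[|//]]] lti ltj etij; [left|right; left|right; right];
  apply: nerve_lax1_eq; rewrite (bool_irrelevance lti isT) (bool_irrelevance ltj isT) in etij.
Qed.
Next Obligation.
move=> G A alpha [alphaC _] x.
pose g i j p q r : G := @lax1 _ 4 x (@Ordinal 5 i p) (@Ordinal 5 j q) r.
have gM i j k p q r ij jk ik : (g i j p q ij * g j k q r jk)%g = g i k p r ik.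
  exact: (@lax2 _ 4 x (Ordinal p) (Ordinal q) (Ordinal r) ij jk ik).
have := alphaC (g 0 1 isT isT isT) (g 1 2 isT isT isT)
               (g 2 3 isT isT isT) (g 3 4 isT isT isT).
rewrite (gM 0 1 2 isT isT isT isT isT isT) (gM 1 2 3 isT isT isT isT isT isT).
rewrite (gM 2 3 4 isT isT isT isT isT isT) => E.
pose face k := nerve_cochain alpha (lax_act (@coface 3 k) x).
have face_g (k : 'I_5) i j l m (pi : (i < 5)%N) (pj : (j < 5)%N) (pl : (l < 5)%N) (pm : (m < 5)%N)
    (ij : (i <= j)%N) (jl : (j <= l)%N) (lm : (l <= m)%N) :
    [/\ bump k 0 = i, bump k 1 = j, bump k 2 = l & bump k 3 = m] ->
    face k = alpha (g i j pi pj ij) (g j l pj pl jl) (g l m pl pm lm).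
  by case=> *; congr alpha; apply: (nerve_lax1 x).
rewrite /coboundary (alternating_sum5 face).
rewrite (face_g _ 1 2 3 4 isT isT isT isT isT isT isT); last by split.
rewrite (face_g _ 0 2 3 4 isT isT isT isT isT isT isT); last by split.
rewrite (face_g _ 0 1 3 4 isT isT isT isT isT isT isT); last by split.
rewrite (face_g _ 0 1 2 4 isT isT isT isT isT isT isT); last by split.
rewrite (face_g _ 0 1 2 3 isT isT isT isT isT isT isT); last by split.
by rewrite [LHS](AC 5 (1 * 3 * 5 * 2 * 4)) /= -addrA -opprD E subrr.
Qed.

Definition classifying (G : groupType) (A : zmodType) (alpha : G -> G -> G -> A)
    (alphaP : normalized_3cocycle alpha) :
    pmap (BTwoGroup (discrete_twogroup G)) (EM A 3) :=
  classifying_map (nerve_cocycle alphaP).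

Lemma oneobj_eq_cell (A : zmodType) (f g : unit) (e : f = g) :
  @eq_cell (deloop (oneobj_moncat A)) tt tt f g e = 0.
Proof. by case: g / e. Qed.

Lemma oneobj_lax2_eq (A : zmodType) n (x : Duskin (deloop (oneobj_moncat A)) n)
    (i j k : 'I_n.+1) p q r : i = j \/ j = k -> @lax2 _ n x i j k p q r = 0.
Proof.
case: x => F0 F1 F2 [F1_1 Fl Fr FA] /= [] e.
  case: j / e p q => p q; have := Fl i k p q.
  by rewrite /= [eq_cell _]oneobj_eq_cell !add0r (bool_irrelevance q r).
case: k / e q r => q r; have := Fr i j q p.
by rewrite /= [eq_cell _]oneobj_eq_cell !add0r (bool_irrelevance p r).
Qed.

Lemma oneobj_lax2_val (A : zmodType) n (x : Duskin (deloop (oneobj_moncat A)) n)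
    (i j k i' j' k' : 'I_n.+1) p q r p' q' r' :
  i = i' :> nat -> j = j' :> nat -> k = k' :> nat ->
  @lax2 _ n x i j k p q r = @lax2 _ n x i' j' k' p' q' r' :> A.
Proof.
move=> /val_inj ei /val_inj ej /val_inj ek; case: i' / ei p' r' => p' r'.
case: j' / ej p' q' => p' q'; case: k' / ek q' r' => q' r'.
by rewrite (bool_irrelevance p p') (bool_irrelevance q q') (bool_irrelevance r r').
Qed.

(* The canonical isomorphism from the Duskin nerve of the delooping of [BA] to
   [K(A, 2)]: it reads off the composition 2-cells. *)
Program Definition oneobj_cocycle (A : zmodType) :
    cocycle A (BTwoGroup (oneobj_twogroup A)) 2 :=
  @Cocycle A (BTwoGroup (oneobj_twogroup A)) 2
    (fun x => @lax2 _ 2 x (@Ordinal 3 0 isT) (@Ordinal 3 1 isT) (@Ordinal 3 2 isT)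
                isT isT isT) _ _.
Next Obligation.
move=> A m t y /mono_ninj[i [j [eij etij]]] /=.
apply: oneobj_lax2_eq; case: i j => [i lti] [j ltj] /= in eij etij *; subst j.
by case: i lti ltj etij => [|[|//]] lti ltj etij; [left|right];
  rewrite (bool_irrelevance lti isT) (bool_irrelevance ltj isT) in etij.
Qed.
Next Obligation.
move=> A x.
pose a i j k p q r ij jk ik : A :=
  @lax2 _ 3 x (@Ordinal 4 i p) (@Ordinal 4 j q) (@Ordinal 4 k r) ij jk ik.
pose face k : A := @lax2 _ 2 (lax_act (@coface 2 k) x)
  (@Ordinal 3 0 isT) (@Ordinal 3 1 isT) (@Ordinal 3 2 isT) isT isT isT.
have face_a (k : 'I_4) i j l (pi : (i < 4)%N) (pj : (j < 4)%N) (pl : (l < 4)%N)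
    (ij : (i <= j)%N) (jl : (j <= l)%N) (il : (i <= l)%N) :
    [/\ bump k 0 = i, bump k 1 = j & bump k 2 = l] ->
    face k = a i j l pi pj pl ij jl il.
  by case=> *; apply: (oneobj_lax2_val x).
rewrite /coboundary (alternating_sum4 face).
rewrite (face_a _ 1 2 3 isT isT isT isT isT isT); last by split.
rewrite (face_a _ 0 2 3 isT isT isT isT isT isT); last by split.
rewrite (face_a _ 0 1 3 isT isT isT isT isT isT); last by split.
rewrite (face_a _ 0 1 2 isT isT isT isT isT isT); last by split.
have E : a 0 1 2 isT isT isT isT isT isT + a 0 2 3 isT isT isT isT isT isT =
         a 1 2 3 isT isT isT isT isT isT + a 0 1 3 isT isT isT isT isT isT.
  have := lax_assoc (lax_ax x) (i := @Ordinal 4 0 isT) (j := @Ordinal 4 1 isT)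
    (k := @Ordinal 4 2 isT) (l := @Ordinal 4 3 isT) isT isT isT isT isT isT.
  by rewrite /= add0r addr0 add0r.
by rewrite [LHS](AC 4 (1 * 3 * (2 * 4))) /= -opprD -E addrC (addrC (a 0 2 3 _ _ _ _ _ _)) addNr.
Qed.

Definition oneobj_to_EM (A : zmodType) :
    pmap (BTwoGroup (oneobj_twogroup A)) (EM A 2) :=
  classifying_map (oneobj_cocycle A).

Lemma coface_max n (k : 'I_n.+1) : coface ord_max k = k :> nat.
Proof. exact: lift_max. Qed.

Lemma interval_end (k : 'I_2) : (k == ord_max) = (k != ord0).
Proof. by case: k => [[|[|]]]. Qed.

(* The cross product of [z] with the fundamental 1-cocycle of [Delta 1]: on
   [(x, t)] it is [z] on the front [n]-face of [x] if the last edge of [t] is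
   the non-degenerate edge of [Delta 1], and 0 otherwise. *)
Definition cross_cochain (A : zmodType) (X : sset) n (z : X n -> A)
    (x : sprod X (Delta 1) n.+1) : A :=
  if (x.2 (coface ord_max ord_max) == ord0) && (x.2 ord_max == ord_max)
  then z (act (coface ord_max) x.1) else 0.

Program Definition cross_interval (A : zmodType) (X : sset) n (z : cocycle A X n) :
    cocycle A (sprod X (Delta 1)) n.+1 :=
  @Cocycle A (sprod X (Delta 1)) n.+1 (cross_cochain z) _ _.
Next Obligation.
move=> A X n z m t y tN; rewrite /cross_cochain /=; case: ifP => // /andP[/eqP e0 /eqP e1].
rewrite -act_comp; apply: cocycle_norm => tI; have [i [j [eij etij]]] := mono_ninj tN.
have [lt_jn|] := ltnP j n.+1; last first.
  rewrite leq_eqVlt [(_ < _)%N]ltnNge -ltnS ltn_ord orbF => /eqP ejn.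
  have ej : j = ord_max by apply: val_inj; rewrite /= -ejn.
  have ei : i = coface ord_max ord_max.
    
    by apply: ord_inj; rewrite lift_max; apply: succn_inj; rewrite -eij -ejn.
  by move: e1; rewrite -ej -etij ei e0.
have lt_in : (i < n.+1)%N by rewrite -eij ltnW.
have: Ordinal lt_in = Ordinal lt_jn.
  apply: tI => /=; set u := lift _ _; set v := lift _ _.
  have -> : u = i by apply: ord_inj; rewrite lift_max.
  by have -> : v = j by apply: ord_inj; rewrite lift_max.
by case=> /= eij'; rewrite eij' in eij; move/n_Sn: eij.
Qed.
Next Obligation.
move=> A X n z x.
set b := x.2 (coface ord_max ord_max); set c := x.2 ord_max.
set a := x.2 (coface ord_max (coface ord_max ord_max)).
have le_ab : (a <= b)%N by apply: mono_le; rewrite !coface_max.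
have le_bc : (b <= c)%N by apply: mono_le; rewrite -ltnS ltn_ord.
pose y := act (coface ord_max) x.1; set w := z (act (coface ord_max) y).
have yE (i : 'I_n.+2) :
    act (coface ord_max) (act (coface (widen_ord (leqnSn n.+2) i)) x.1) = act (coface i) y.
  rewrite /y -!act_comp; congr act; apply: mono_eq => k; apply: ord_inj.
  by rewrite -[LHS]/(bump i (coface ord_max k)) -[RHS]/(nat_of_ord (coface ord_max (coface i k)))
    !coface_max.
have term (i : 'I_n.+2) : (i <= n)%N ->
    cross_cochain z (act (coface (widen_ord (leqnSn n.+2) i)) x) =
    if (b == ord0) && (c == ord_max) then z (act (coface i) y) else 0.
  move=> le_in; rewrite /cross_cochain -yE.
  congr (if (x.2 _ == _) && (x.2 _ == _) then _ else _); apply: ord_inj.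
    rewrite -[LHS]/(bump i (coface ord_max ord_max)) !coface_max /=.
    by rewrite /bump le_in.
  by rewrite -[LHS]/(bump i n.+1) /bump (leq_trans le_in).
have termB : cross_cochain z (act (coface (widen_ord (leqnSn n.+2) ord_max)) x) =
    if (a == ord0) && (c == ord_max) then w else 0.
  rewrite /cross_cochain yE.
  congr (if (x.2 _ == _) && (x.2 _ == _) then _ else _); apply: ord_inj.
    rewrite -[LHS]/(bump n.+1 (coface ord_max ord_max)) !coface_max /=.
    by rewrite /bump ltnn.
  by rewrite -[LHS]/(bump n.+1 n.+1) /bump leqnn.
have termC : cross_cochain z (act (coface ord_max) x) =
  if (a == ord0) && (b == ord_max) then w else 0 by [].
have := cocycle_closed z y; rewrite /coboundary big_ord_recr /= -/w => zC.
rewrite big_ord_recr termC big_ord_recr termB /=.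
rewrite (eq_bigr (fun i : 'I_n.+1 => (if (b == ord0) && (c == ord_max)
   then z (act (coface (widen_ord (leqnSn n.+1) i)) y) else 0) *~ (-1) ^+ i)); last first.
  by move=> i _; rewrite term //= -ltnS.
rewrite [b == ord_max]interval_end; have [eb|nb] /= := eqVneq b ord0.
  have -> : a = ord0 by apply/ord_inj/eqP; rewrite -leqn0; move: le_ab; rewrite eb.
  rewrite eqxx /= mul0rz addr0; case: (c == ord_max) => //.
  by rewrite mul0rz addr0 big1 // => i _; rewrite mul0rz.
have -> : c == ord_max.
  by rewrite interval_end; apply: contra nb => /eqP ec;
    apply/eqP/ord_inj/eqP; rewrite -leqn0; move: le_bc; rewrite ec.
rewrite big1 ?add0r => [|i _]; last by rewrite mul0rz.
by rewrite !andbT [_ ^+ n.+2]exprS mulN1r mulrNz subrr.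
Qed.

(* The standard identification [K(A, n) -> Omega K(A, n+1)] with the sign
   adapted to paths which, in the homotopy fiber, start at the value of the
   map and end at the base point; the other standard one is its composite with
   inversion in [A]. *)
Program Definition EM_loop_simplex (A : zmodType) n m (z : EM A n m) :
    Loop (EM A n.+1) m :=
  @HpbSimplex point point (EM A n.+1) (point_incl _) (point_incl _) m
    (ptn point m) (ptn point m) (classifying_smap (cross_interval z)) _.
Next Obligation.
by move=> A n m z l t; split; apply: cocycle_eq => s; rewrite /= /cross_cochain.
Qed.

Program Definition EM_loop (A : zmodType) n : pmap (EM A n) (Loop (EM A n.+1)) :=
  @PMap (EM A n) (Loop (EM A n.+1))
    (@SMap (EM A n) (Loop (EM A n.+1)) (@EM_loop_simplex A n) _) _.
Next Obligation.
move=> A n l m t z; apply: hpb_eq => // k s r; apply: cocycle_eq => q /=.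
by rewrite /cross_cochain.
Qed.
Next Obligation.
move=> A n; apply: hpb_eq => [||k s r] /=.
- by apply: mono_eq => i; rewrite [RHS]ord1.
- by apply: mono_eq => i; rewrite [RHS]ord1.
by apply: cocycle_eq => q /=; rewrite /cross_cochain; case: ifP.
Qed.

Definition hofib_extension (A : zmodType) (BH : psset) (c : pmap BH (EM A 3)) :
    extension (BTwoGroup (oneobj_twogroup A)) BH :=
  @Extension (BTwoGroup (oneobj_twogroup A)) BH (hofib c)
    (pcomp (loop_to_hofib c) (pcomp (EM_loop A 2) (oneobj_to_EM A)))
    (hofib_proj c).

End Nerves.

(* Main.v *)
(** A map from [Y] to the homotopy fiber of the map classifying a cocycle [z]
is a map [p] to the base together with a cocycle on the cylinder [Y x Delta 1]
which restricts to [p^* z] at the source and to 0 at the target. Integrating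
the universal such cocycle along the fibers of the cylinder gives a primitive
of it that vanishes at the target; minus its restriction to the source is a
cochain [a] on the homotopy fiber with [delta a = - p^* z]. On the other hand,
a map to the nerve of [G_alpha] is exactly a map [p] to [BG] together with a
normalized 2-cochain [a] such that [delta a = - p^* alpha]: the 2-cells of a
strictly unitary lax functor form [a], and its associativity axiom is this
equation. So a cone construction on [a] and fiber integration give maps in both
directions. The composite on [BG_alpha] is the identity, and the one on the
homotopy fiber is homotopic to the identity since both are given by coboundaries
of primitives on the cylinder with the same restrictions to its two ends. *)

From mathcomp Require Import all_boot all_algebra zify.
From Stdlib Require Import FunctionalExtensionality ProofIrrelevance.
Require Import Defs.

Set Implicit Arguments.
Unset Strict Implicit.
Unset Printing Implicit Defensive.

Import GRing.Theory.

#[local] Obligation Tactic := idtac.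

(** * Simplicial cochains and their coboundary *)

Section Cochains.
Local Open Scope ring_scope.

Lemma coface_coface n (a b : 'I_n.+2) : (b <= a)%N ->
  mono_comp (coface (lift ord0 a)) (coface b) =
  mono_comp (coface (widen_ord (leqnSn _) b)) (coface a).
Proof.
move=> le_ba; apply: mono_eq => k; apply: ord_inj => /=.
by rewrite /bump; lia.
Qed.

Lemma coboundary_pullback (A : zmodType) (X Y : sset) n (f : smap X Y) (z : Y n -> A) x :
  coboundary (fun x => z (f n x)) x = coboundary z (f n.+1 x).
Proof. by apply: eq_bigr => i _; rewrite smap_nat. Qed.

Lemma eq_coboundary (A : zmodType) (X : sset) n (z w : X n -> A) :
  z =1 w -> coboundary z =1 coboundary w.
Proof. by move=> e x; apply: eq_bigr => i _; rewrite e. Qed.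

Lemma coboundaryN (A : zmodType) (X : sset) n (z : X n -> A) x :
  coboundary (fun x => - z x) x = - coboundary z x.
Proof. by rewrite -sumrN; apply: eq_bigr => i _; rewrite mulNrz. Qed.

(** The term at [(i, j) = (a.+1, b)] with [b <= a] is evaluated on the same face as the one at
    [(b, a)], with the opposite sign. *)
Lemma coboundary_coboundary (A : zmodType) (X : sset) n (z : X n -> A) x :
  coboundary (coboundary z) x = 0.
Proof.
pose F (i : 'I_n.+3) (j : 'I_n.+2) : A :=
  z (act (coface j) (act (coface i) x)) *~ (-1) ^+ (i + j).
have -> : coboundary (coboundary z) x = \sum_i \sum_j F i j.
  apply: eq_bigr => i _; rewrite mulrz_suml; apply: eq_bigr => j _.
  by rewrite -mulrzA mulrC -exprD.
have -> : \sum_i \sum_j F i j =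
    \sum_(i < n.+3) \sum_(j < n.+2 | (j < i)%N) F i j +
    \sum_(i < n.+3) \sum_(j < n.+2 | ~~ (j < i)%N) F i j.
  by rewrite -big_split /=; apply: eq_bigr => i _;
    rewrite (bigID (fun j : 'I_n.+2 => (j < i)%N)).
(* No [j] lies below [i = 0] and every [j] lies below the last [i], so both sums become sums over
   the pairs [b <= a]. *)
rewrite big_ord_recl /= big1 // add0r.
rewrite [X in _ + X]big_ord_recr /= [X in _ + (_ + X)]big1 ?addr0; last first.
  by move=> j; rewrite ltn_ord.
rewrite [X in _ + X](exchange_big_dep xpredT) //= -big_split big1 //= => a _.
rewrite (eq_bigl (fun b : 'I_n.+2 => (b <= a)%N)); last by move=> b; rewrite /= /bump; lia.
rewrite [X in _ + X](eq_bigl (fun b : 'I_n.+2 => (b <= a)%N)); last by move=> b /=; lia.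
rewrite -big_split big1 //= => b le_ba.
rewrite /F -!act_comp coface_coface //=.
by rewrite /bump /= add1n addSn exprS mulN1r mulrNz addnC addNr.
Qed.

(** If [t] identifies [i] and [i.+1], these two faces of [act t y] coincide and cancel by sign;
    every other face is still degenerate. *)
Lemma coboundary_normalized (A : zmodType) (X : sset) n (z : X n -> A) :
  normalized z -> normalized (coboundary z).
Proof.
move=> zN m t y /mono_ninj[i [j [eij etij]]].
have ne : j != i by rewrite -val_eqE /= eij; lia.
rewrite /coboundary (bigD1 i) // (bigD1 j) //= addrA big1 ?addr0 => [|k /andP[nki nkj]].
  rewrite eij exprS mulN1r mulrNz; apply/eqP; rewrite subr_eq0; apply/eqP.
  rewrite -!act_comp; congr (z (act _ _) *~ _); apply: mono_eq => k /=.
  have [eki|nki] := eqVneq (k : nat) i; last first.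
    by congr (t _); apply: ord_inj; rewrite /= /bump; lia.
  transitivity (t j); first by congr (t _); apply: ord_inj; rewrite /= /bump; lia.
  by rewrite -etij; congr (t _); apply: ord_inj; rewrite /= /bump; lia.
rewrite -act_comp zN ?mul0rz //= => tI.
have [i' ei'] := unlift_some nki; have [j' ej'] := unlift_some nkj.
have e : i' = j' by apply: tI => /=; rewrite -ei' -ej'.
by move: ne; rewrite ei' ej' e eqxx.
Qed.

Definition coboundary_cocycle (A : zmodType) (X : sset) n (z : X n -> A)
    (zN : normalized z) : cocycle A X n.+1 :=
  Cocycle (coboundary_normalized zN) (@coboundary_coboundary A X n z).

(** The map [e] collapses [i] onto its successor, so a simplex that it fixes is degenerate.
    Quantifying over all [e] with these values spares each use a proof of monotonicity. *)
Lemma normalized_adjacent (A : zmodType) (X : sset) n (z : X n -> A) (x : X n)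
    (i j : 'I_n.+1) : j = i.+1 :> nat -> normalized z ->
  (forall e : mono n n, e =1 [eta id with i |-> j] -> act e x = x) -> z x = 0.
Proof.
move=> eij zN xP.
have e_le (k l : 'I_n.+1) : (k <= l)%N ->
    ([eta id with i |-> j] k <= [eta id with i |-> j] l)%N.
  move=> le_kl /=; case: eqP => [ek|nk]; case: eqP => [el|nl] //; last by rewrite eij -el; lia.
  have : (l : nat) != i by apply/eqP => /ord_inj.
  by subst; lia.
rewrite -(xP (Mono e_le) (fun=> erefl)); apply: zN => /(_ i j) /=.
rewrite eqxx; case: eqP => // _ /(_ erefl) e; move: eij; rewrite e; lia.
Qed.
End Cochains.

(** * Integration along the fibers of a cylinder *)

Section FiberIntegral.
Local Open Scope ring_scope.

Lemma codegen_lt n (i : 'I_n.+1) (k : 'I_n.+2) : (k - (i < k) < n.+1)%N.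
Proof. by have := ltn_ord k; have := ltn_ord i; lia. Qed.

Lemma codegen_le n (i : 'I_n.+1) (j k : 'I_n.+2) : (j <= k)%N ->
  (Ordinal (codegen_lt i j) <= Ordinal (codegen_lt i k))%N.
Proof. by move=> /=; lia. Qed.

(** The codegeneracy that takes the value [i] at both [i] and [i.+1]: its formula [k - (i < k)]
    reads the boolean as 0 or 1. *)
Definition codegen n (i : 'I_n.+1) : mono n.+1 n := Mono (codegen_le i).

Lemma step_le m j (k l : 'I_m.+1) : (k <= l)%N ->
  ((if (k < j)%N then ord0 else ord_max : 'I_2) <=
   (if (l < j)%N then ord0 else ord_max : 'I_2))%N.
Proof. by case: (ltnP k j) => //; case: (ltnP l j) => //= *; lia. Qed.

(** The first [j] vertices lie at 0 and the others at 1, so [j = 0] gives [tgt m] and [j = m.+1]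
    gives [src m]. *)
Definition step m j : Delta 1 m := Mono (@step_le m j).

Lemma step0 m : step m 0 = tgt m. Proof. exact: mono_eq. Qed.

Lemma ord2_eq0 (x y : 'I_2) : (x == ord0) = (y == ord0) -> x = y.
Proof. by case: x y => [[|[|//]] p] [[|[|//]] q] // _; apply: ord_inj. Qed.

Lemma step_eq0 m j (k : 'I_m.+1) : (step m j k == ord0) = (k < j)%N.
Proof. by rewrite /=; case: ltnP. Qed.

Lemma interval_step m (t : Delta 1 m) : exists2 j, (j <= m.+1)%N & t = step m j.
Proof.
(* One more than the last vertex at 0; the empty maximum gives 0 if there is none. *)
exists (\max_(k < m.+1 | t k == ord0) k.+1); first by apply/bigmax_leqP => k _.
apply: mono_eq => k; apply: ord2_eq0; rewrite step_eq0.
apply/idP/idP => [t0|].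
  exact: (@leq_bigmax_cond _ (fun k => t k == ord0) (fun k => k.+1) k t0).
apply: contraLR => t1; rewrite -leqNgt; apply/bigmax_leqP => l /eqP tl.
rewrite ltnNge; apply: contra t1 => le_kl.
have : (t k <= t l)%N by apply: mono_le.
by rewrite tl leqn0.
Qed.

(* The maximal simplices of the prism over [y]. *)
Definition prism (Y : sset) n (y : Y n) (i : 'I_n.+1) : sprod Y (Delta 1) n.+1 :=
  (act (codegen i) y, step n.+1 i.+1).

(** Together with [prism_bottom]: consecutive maximal simplices of the prism share a face, which
    makes sums over them telescope. *)
Lemma prism_top (Y : sset) n (y : Y n) i :
  act (coface (widen_ord (leqnSn _) i)) (prism y i) = (y, step n i).
Proof.
rewrite /prism /= -act_comp; congr pair.
  rewrite -[RHS]act_id; congr act; apply: mono_eq => k; apply: ord_inj.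
  by rewrite /= /bump; case: (leqP i k) => /=; lia.
apply: mono_eq => k; apply: ord2_eq0; rewrite !step_eq0 /= /bump.
by case: (ltnP k i); lia.
Qed.

Lemma prism_bottom (Y : sset) n (y : Y n) i :
  act (coface (lift ord0 i)) (prism y i) = (y, step n i.+1).
Proof.
rewrite /prism /= -act_comp; congr pair.
  rewrite -[RHS]act_id; congr act; apply: mono_eq => k; apply: ord_inj.
  by rewrite /= /bump /= !add1n; case: (ltnP i k) => /=; lia.
apply: mono_eq => k; apply: ord2_eq0; rewrite !step_eq0 /= /bump /= !add1n.
by case: (ltnP i k) => /=; lia.
Qed.

(** The remaining faces form the prism over the boundary of [y]. Such a face has number [l] in the
    maximal simplices after the [l]-th and [l.+1] in those before it, which the outer [lift]
    encodes. *)
Lemma prism_side (Y : sset) n (y : Y n.+1) (l : 'I_n.+2) (i : 'I_n.+1) :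
  act (coface (lift (widen_ord (leqnSn _) (lift l i)) l)) (prism y (lift l i)) =
  prism (act (coface l) y) i.
Proof.
rewrite /prism /= -!act_comp; congr pair.
  congr act; apply: mono_eq => k; apply: ord_inj.
  rewrite /= /bump; case: (leqP l i) => /= ?; case: (leqP _ k) => /= ?;
    by case: (leqP l _) => /=; lia.
apply: mono_eq => k; apply: ord2_eq0; rewrite !step_eq0 /= /bump.
case: (leqP l i) => /= ?; case: (leqP l k) => /=; lia.
Qed.

(* Minus the integral of [z] over the part of the fiber interval lying above
   the last vertex of [w.1] that [w.2] sends to [0]. *)
Definition fiber_integral (A : zmodType) (Y : sset) n
    (z : sprod Y (Delta 1) n.+1 -> A) (w : sprod Y (Delta 1) n) : A :=
  - \sum_(i < n.+1 | w.2 i == ord0) z (prism w.1 i) *~ (-1) ^+ i.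

Lemma fiber_integral_normalized (A : zmodType) (Y : sset) n
    (z : sprod Y (Delta 1) n.+1 -> A) :
  normalized z -> normalized (fiber_integral z).
Proof.
move=> zN m t y /mono_ninj[i [j [eij etij]]].
rewrite /fiber_integral big1 ?oppr0 // => k _; rewrite /prism /= -act_comp.
(* Adjacent vertices over [i] and [j] on the same side of the step make the maximal simplex
   degenerate. They are [i] and [j] themselves, shifted by one if [k <= i]. *)
have zero (p q : 'I_n.+2) : q = p.+1 :> nat -> codegen k p = i -> codegen k q = j ->
    (p < k.+1)%N = (q < k.+1)%N ->
    z (act (mono_comp t (codegen k)) y.1, step n.+1 k.+1) *~ (-1) ^+ k = 0.
  move=> eq ep eq' epq; rewrite (@normalized_adjacent A _ _ z _ p q) ?mul0rz //.
  move=> e eE /=; congr pair; [rewrite -act_comp; congr act|];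
    apply: mono_eq => l; rewrite /= eE /=; case: eqP => // ->.
    by rewrite -[LHS]/(t (codegen k q)) -[RHS]/(t (codegen k p)) ep eq' etij.
  by rewrite epq.
have [le_ki|lt_ik] := leqP k i.
  apply: (zero (lift ord0 i) (lift ord0 j)); try apply: ord_inj;
    by rewrite /= /bump /= ?eij ?add1n //; lia.
apply: (zero (widen_ord (leqnSn _) i) (widen_ord (leqnSn _) j)) => //=; try apply: ord_inj;
  by rewrite /= ?eij //; lia.
Qed.

(** Stokes' theorem on the part of the prism between the target and the section [step j]: the
    cocycle condition on its maximal simplices sums to 0, shared faces cancel, and the side faces
    give the coboundary of the integral. *)
Lemma coboundary_fiber_integral (A : zmodType) (Y : sset) n
    (z : sprod Y (Delta 1) n.+1 -> A) :
  (forall w, coboundary z w = 0) -> (forall y, z (y, tgt n.+1) = 0) ->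
  coboundary (fiber_integral z) =1 z.
Proof.
move=> zC zT [y t]; have [j le_j ->] := interval_step t.
pose F (i : 'I_n.+2) (l : 'I_n.+3) : A := z (act (coface l) (prism y i)) *~ (-1) ^+ (i + l).
pose w := widen_ord (leqnSn n.+2).
have total : \sum_(i < n.+2 | (i < j)%N) \sum_(l < n.+3) F i l = 0.
  apply: big1 => i _; transitivity (coboundary z (prism y i) *~ (-1) ^+ i).
    by rewrite mulrz_suml; apply: eq_bigr => l _; rewrite /F exprD mulrC mulrzA.
  by rewrite zC mul0rz.
have split (i : 'I_n.+2) : \sum_(l < n.+3) F i l =
    z (y, step n.+1 i) - z (y, step n.+1 i.+1)
    + \sum_(l < n.+2 | l != i) F i (lift (w i) l).
  rewrite (bigD1_ord (w i)) //= (bigD1 i) //= addrA; congr (_ + _ + _).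
    by rewrite /F prism_top /= addnn -mul2n exprM sqrrN !expr1n.
  have -> : lift (w i) i = lift ord0 i by apply: ord_inj; rewrite /= /bump /=; lia.
  rewrite /F prism_bottom /= /bump /= add1n addnS addnn -mul2n exprS exprM sqrrN !expr1n.
  by rewrite mulr1 mulrN1z.
move: total; rewrite (eq_bigr _ (fun i _ => split i)) big_split /=.
have -> : \sum_(i < n.+2 | (i < j)%N) (z (y, step n.+1 i) - z (y, step n.+1 i.+1)) =
    - z (y, step n.+1 j).
  rewrite -(big_ord_widen _ (fun i => z (y, step n.+1 i) - z (y, step n.+1 i.+1)) le_j).
  (* Telescoping leaves the two end sections; [step 0] is the target, where [z] vanishes. *)
  transitivity (- (z (y, step n.+1 j) - z (y, step n.+1 0))); last by rewrite step0 zT subr0.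
  rewrite -(telescope_sumr (fun i => z (y, step n.+1 i))) //.
  by rewrite big_mkord -sumrN; apply: eq_bigr => i _; rewrite opprB.
move/eqP; rewrite addrC subr_eq0 => /eqP <-.
rewrite (exchange_big_dep xpredT) //=; apply: eq_bigr => l _.
rewrite /fiber_integral mulNrz mulrz_suml -sumrN.
rewrite [RHS]big_mkcond (bigD1_ord l) //= eqxx andbF add0r -big_mkcond /=.
apply: eq_big => [i|i _]; first by rewrite neq_lift andbT; case: ifP.
(* For either position of [l], the exponent of a side face is [i + l + 1]; this extra sign is the
   minus in [fiber_integral]. *)
rewrite /F prism_side -mulrzA -exprD -mulrNz; congr (_ *~ _).
rewrite -[LHS]mulN1r -exprS; congr (_ ^+ _); rewrite /= /bump.
by case: (leqP l i) => ? /=; case: leqP => /=; lia.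
Qed.
End FiberIntegral.

(** * Cones on cochains *)

Section Cone.
Local Open Scope ring_scope.
Variables (A : zmodType) (Y : sset) (n : nat).

(* Minus the cup product of [a] with the 0-cochain of [Delta 1] that is 1 on
   the source: a primitive of a cocycle on the cylinder that ends at 0. *)
Definition cone_cochain (a : Y n -> A) (w : sprod Y (Delta 1) n) : A :=
  if w.2 ord_max == ord0 then - a w.1 else 0.

Lemma cone_cochain_normalized (a : Y n -> A) : normalized a -> normalized (cone_cochain a).
Proof. by move=> aN m t y tN; rewrite /cone_cochain /= aN // oppr0 if_same. Qed.

(** If the last vertex lies at 0, so do all vertices. Otherwise every face but the last one keeps a
    last vertex at 1 and contributes 0. *)
Lemma coboundary_cone (a : Y n -> A) (w : sprod Y (Delta 1) n.+1) :
  coboundary (cone_cochain a) w =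
  if w.2 ord_max == ord0 then - coboundary a w.1 else cross_cochain a w *~ (-1) ^+ n.
Proof.
have max_eq (i : 'I_n.+1) : coface (widen_ord (leqnSn n.+1) i) ord_max = ord_max.
  by apply: ord_inj; rewrite /= /bump; case: leqP => //=; have := ltn_ord i; lia.
have le_max : (w.2 (coface ord_max ord_max) <= w.2 ord_max)%N.
  by apply: mono_le; rewrite coface_max.
case: (eqVneq (w.2 ord_max) ord0) => [w0|w1].
  rewrite -coboundaryN; apply: eq_bigr => i _; congr (_ *~ _); rewrite /cone_cochain /=.
  have -> // : w.2 (lift i ord_max) = ord0.
  apply/ord_inj/eqP; rewrite -leqn0 -[X in (_ <= X)%N]/(nat_of_ord (@ord0 1)) -w0.
  by apply: mono_le; rewrite -ltnS ltn_ord.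
rewrite /coboundary big_ord_recr big1 /= => [|i _]; last first.
  rewrite -[cone_cochain _ _]/(if w.2 (coface (widen_ord (leqnSn n.+1) i) ord_max) == ord0
    then - a (act (coface (widen_ord (leqnSn n.+1) i)) w.1) else 0).
  by rewrite max_eq (negPf w1) mul0rz.
rewrite add0r /cross_cochain [_ == ord_max]interval_end w1 andbT.
rewrite -[cone_cochain _ _]/(if w.2 (coface ord_max ord_max) == ord0
  then - a (act (coface ord_max) w.1) else 0).
by case: ifP => _; rewrite ?mul0rz // exprS mulN1r mulrNz mulNrz opprK.
Qed.
End Cone.

(** * Maps to Eilenberg-MacLane spaces and to homotopy fibers as cocycles *)

Section HomotopyFiber.
Local Open Scope ring_scope.
Variables (A : zmodType) (n : nat).

(** The inverse of [classifying_smap]: the pullback of the tautological cocycle, which evaluates at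
    the fundamental simplex. *)
Program Definition cocycle_of_smap (X : sset) (f : smap X (EM_sset A n)) : cocycle A X n :=
  @Cocycle A X n (fun x => f n x (mono_id n)) _ _.
Next Obligation.
move=> X f m t y tN; rewrite smap_nat /=.
have -> : mono_comp t (mono_id n) = act t (mono_id m : Delta m m) by apply: mono_eq.
exact: cocycle_norm.
Qed.
Next Obligation.
move=> X f x; rewrite -(cocycle_closed (f n.+1 x) (mono_id _)).
apply: eq_bigr => i _; congr (_ *~ _); rewrite smap_nat /=.
by congr (f _ _ _); apply: mono_eq.
Qed.

Lemma smap_EM_val (X : sset) (f : smap X (EM_sset A n)) m (x : X m) (s : Delta m n) :
  f m x s = cocycle_of_smap f (act s x).
Proof. by rewrite /= smap_nat /=; congr (f _ _ _); apply: mono_eq. Qed.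

Section Universal.
Variables (X : psset) (c : pmap X (EM A n)).

(** The universal path, uncurried; [path_cocycle] below is the cocycle on the cylinder that it
    represents. *)
Program Definition hofib_eval : smap (sprod (hofib c) (Delta 1)) (EM_sset A n) :=
  @SMap (sprod (hofib c) (Delta 1)) (EM_sset A n)
    (fun m w => hpb_path w.1 m (mono_id m, w.2)) _.
Next Obligation.
by move=> l m t [u s]; rewrite -smap_nat /=; congr (hpb_path u l (_, _)); apply: mono_eq.
Qed.

Definition path_cocycle := cocycle_of_smap hofib_eval.

Lemma path_cocycle_val (u : hofib c n) (s : Delta 1 n) :
  path_cocycle (u, s) = hpb_path u n (mono_id n, s) (mono_id n).
Proof. by []. Qed.

Lemma path_cocycle_src (u : hofib c n) :
  path_cocycle (u, src n) = cocycle_of_smap c (hpb_fst u).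
Proof. by have [e _] := hpb_ends u (mono_id n); rewrite /= e act_id. Qed.

Lemma path_cocycle_tgt (u : hofib c n) : path_cocycle (u, tgt n) = 0.
Proof. by have [_ e] := hpb_ends u (mono_id n); rewrite /= e. Qed.

(** Uniqueness in the universal property of the homotopy fiber: each value of a path is a value of
    [path_cocycle], and the component in the point carries no data. *)
Lemma hofib_eq m (u v : hofib c m) : hpb_fst u = hpb_fst v ->
  (forall (r : mono n m) (s : Delta 1 n),
     path_cocycle (act r u, s) = path_cocycle (act r v, s)) -> u = v.
Proof.
move=> efst epath; apply: hpb_eq => //.
  by apply: mono_eq => i; rewrite [LHS]ord1 [RHS]ord1.
move=> k t s; apply: cocycle_eq => r.
have val_path (w : hofib c m) :
    hpb_path w k (t, s) r = path_cocycle (act (mono_comp t r) w, mono_comp s r).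
  rewrite smap_EM_val /=; congr (hpb_path w _ (_, _) _); exact: mono_eq.
by rewrite !val_path.
Qed.

Variables (Y : sset) (p : smap Y X) (z : cocycle A (sprod Y (Delta 1)) n).
Hypothesis z_src : forall y, z (y, src n) = cocycle_of_smap c (p n y).
Hypothesis z_tgt : forall y, z (y, tgt n) = 0.

(** Existence in the universal property: the path over [y] classifies the restriction of [z] to the
    cylinder over [y]. *)
Program Definition hofib_lift_simplex m (y : Y m) : hofib c m :=
  @HpbSimplex X point (EM A n) c (point_incl _) m (p m y) (ptn point m)
    (classifying_smap (cocycle_pullback (sprod_map (yoneda y) (sid (Delta 1))) z)) _.
Next Obligation.
move=> m y k t; split; apply: cocycle_eq => r /=.
  have -> : mono_comp (src k) r = src n by apply: mono_eq.
  by rewrite z_src smap_nat -smap_EM_val.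
have -> : mono_comp (tgt k) r = tgt n by apply: mono_eq.
exact: z_tgt.
Qed.

Program Definition hofib_lift : smap Y (hofib c) := @SMap Y (hofib c) hofib_lift_simplex _.
Next Obligation.
move=> l m t y; apply: hpb_eq; rewrite /= ?smap_nat //.
by move=> k r s; apply: cocycle_eq => q /=; rewrite -!act_comp.
Qed.

Lemma path_cocycle_lift y (s : Delta 1 n) : path_cocycle (hofib_lift n y, s) = z (y, s).
Proof.
rewrite path_cocycle_val /=; congr (z _).
by rewrite /= act_id; congr pair; apply: mono_eq.
Qed.
End Universal.

End HomotopyFiber.

(** * Primitives of cocycles and maps to the homotopy fiber *)

Section Primitives.
Local Open Scope ring_scope.

Lemma act_ptn (X : psset) m n (t : mono m n) : act t (ptn X n) = ptn X m.
Proof. by rewrite /ptn -act_comp; congr act; apply: mono_eq. Qed.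

Lemma normalized_pt (A : zmodType) (X : sset) (x : X 0) n (z : X n.+1 -> A) t :
  normalized z -> z (act t x) = 0.
Proof. by move=> zN; apply/zN/mono0_ninj. Qed.

Lemma cocycle_of_classifying_smap (A : zmodType) (X : sset) n (z : cocycle A X n) x :
  cocycle_of_smap (classifying_smap z) x = z x.
Proof. by rewrite /= act_id. Qed.

Program Definition at_src (Y : sset) : smap Y (sprod Y (Delta 1)) :=
  @SMap Y (sprod Y (Delta 1)) (fun n y => (y, src n)) _.
Next Obligation. by move=> Y m n t y; congr pair; apply: mono_eq. Qed.

Program Definition at_tgt (Y : sset) : smap Y (sprod Y (Delta 1)) :=
  @SMap Y (sprod Y (Delta 1)) (fun n y => (y, tgt n)) _.
Next Obligation. by move=> Y m n t y; congr pair; apply: mono_eq. Qed.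

Variables (A : zmodType) (X : psset) (n : nat) (z : cocycle A X n.+2).
Let c := classifying_map z.

Section PrimitiveLift.
Variables (Y : sset) (p : smap Y X) (a : Y n.+1 -> A).
Hypotheses (aN : normalized a) (aC : forall y, coboundary a y = - z (p n.+2 y)).

Let cone := coboundary_cocycle (cone_cochain_normalized aN).

Lemma cone_src y : cone (y, src n.+2) = cocycle_of_smap c (p n.+2 y).
Proof. by rewrite cocycle_of_classifying_smap /= coboundary_cone /= aC opprK. Qed.

Lemma cone_tgt y : cone (y, tgt n.+2) = 0.
Proof. by rewrite /= coboundary_cone /= /cross_cochain /= mul0rz. Qed.

Definition primitive_lift : smap Y (hofib c) := hofib_lift cone_src cone_tgt.

Lemma path_cocycle_primitive_lift y s : path_cocycle c (primitive_lift n.+2 y, s) =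
  if s ord_max == ord0 then z (p n.+2 y) else cross_cochain a (y, s) *~ (-1) ^+ n.+1.
Proof. by rewrite path_cocycle_lift /= coboundary_cone /= aC opprK. Qed.

Lemma primitive_lift_pt (y : Y 0) : p 0 y = pt X -> primitive_lift 0 y = pt (hofib c).
Proof.
move=> py; apply: hofib_eq => // r s.
rewrite -smap_nat path_cocycle_primitive_lift smap_nat normalized_pt; last exact: cocycle_norm.
rewrite [RHS]/= /cross_cochain /= -act_comp normalized_pt //.
by rewrite if_same mul0rz if_same.
Qed.
End PrimitiveLift.

Definition path_primitive : sprod (hofib c) (Delta 1) n.+1 -> A :=
  fiber_integral (path_cocycle c).

Lemma path_primitive_normalized : normalized path_primitive.
Proof. by apply: fiber_integral_normalized; apply: cocycle_norm. Qed.

Lemma coboundary_path_primitive : coboundary path_primitive =1 path_cocycle c.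
Proof.
by apply: coboundary_fiber_integral => [w|y]; [apply: cocycle_closed | apply: path_cocycle_tgt].
Qed.

Lemma path_primitive_tgt u : path_primitive (u, tgt n.+1) = 0.
Proof. by rewrite /path_primitive /fiber_integral big1 ?oppr0. Qed.

Definition fiber_cochain (u : hofib c n.+1) : A := - path_primitive (u, src n.+1).

Lemma fiber_cochain_normalized : normalized fiber_cochain.
Proof.
move=> m t u tN; rewrite /fiber_cochain -[(_, _)]/(at_src _ n.+1 _) smap_nat.
by rewrite path_primitive_normalized ?oppr0.
Qed.

Lemma coboundary_fiber_cochain u : coboundary fiber_cochain u = - z (hofib_proj c n.+2 u).
Proof.
rewrite coboundaryN; congr (- _).
rewrite (coboundary_pullback (at_src _)) coboundary_path_primitive path_cocycle_src.
exact: cocycle_of_classifying_smap.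
Qed.

(** Only the last maximal simplex of the prism crosses the interval along its last edge, so it alone
    contributes; the sign [(-1) ^+ n.+1] occurs twice and cancels. *)
Lemma fiber_cochain_primitive_lift (Y : sset) (p : smap Y X) (a : Y n.+1 -> A)
    (aN : normalized a) (aC : forall y, coboundary a y = - z (p n.+2 y)) y :
  fiber_cochain (primitive_lift aN aC n.+1 y) = a y.
Proof.
have bottom : act (coface ord_max) (act (codegen ord_max) y) = y.
  rewrite -[RHS]/(y, step n.+1 n.+2).1 -(prism_bottom y ord_max) /=; congr (act (coface _) _).
  exact: ord_inj.
have pathE (i : 'I_n.+2) : path_cocycle c (prism (primitive_lift aN aC n.+1 y) i) =
    if i == ord_max then a y *~ (-1) ^+ n.+1 else 0.
  rewrite /prism -smap_nat path_cocycle_primitive_lift step_eq0 [(_ < _)%N]ltnNge ltn_ord /=.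
  rewrite /cross_cochain interval_end !step_eq0 coface_max !ltnS /=.
  rewrite [(n.+2 <= i)%N]leqNgt ltn_ord andbT.
  have -> : (n < i)%N = (i == ord_max).
    by rewrite -val_eqE /=; have := ltn_ord i; lia.
  by case: eqP => [->|_]; rewrite ?bottom ?mul0rz.
rewrite /fiber_cochain /path_primitive /fiber_integral opprK (bigD1 ord_max) //.
rewrite big1 => [|i /andP[_ /negPf ni]]; last by rewrite pathE ni mul0rz.
by rewrite pathE eqxx -mulrzA -exprD addnn -mul2n exprM sqrrN !expr1n [LHS]addr0.
Qed.

(* The two branches agree at both ends of the cylinder [w.2], so that the
   coboundary has the restrictions required of a path. *)
Definition interpolation (w : sprod (sprod (hofib c) (Delta 1)) (Delta 1) n.+1) : A :=
  if w.1.2 ord_max == ord0 then cone_cochain fiber_cochain (w.1.1, w.2)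
  else path_primitive (w.1.1, w.2).

Lemma interpolation_normalized : normalized interpolation.
Proof.
move=> m t w tN; rewrite /interpolation.
have := cone_cochain_normalized fiber_cochain_normalized (w.1.1, w.2) tN.
have := path_primitive_normalized (w.1.1, w.2) tN.
by rewrite /= => -> ->; rewrite if_same.
Qed.

Let interp := coboundary_cocycle interpolation_normalized.

Program Definition hofib_cylinder_proj : smap (sprod (hofib c) (Delta 1)) X :=
  @SMap (sprod (hofib c) (Delta 1)) X (fun _ w => hpb_fst w.1) _.
Next Obligation. by []. Qed.

Program Definition cylinder_fst (Y : sset) : smap (sprod Y (Delta 1)) Y :=
  @SMap (sprod Y (Delta 1)) Y (fun _ w => w.1) _.
Next Obligation. by []. Qed.

Lemma interp_src y : interp (y, src n.+2) = cocycle_of_smap c (hofib_cylinder_proj n.+2 y).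
Proof.
rewrite [LHS]/= -[(y, _)]/(at_src _ n.+2 y) -coboundary_pullback.
(* At the source both branches of [interpolation] equal [path_primitive], by the definition of
   [fiber_cochain], so the homotopy parameter drops out. *)
rewrite (@eq_coboundary _ _ _ _
  (fun w => path_primitive (at_src _ n.+1 (cylinder_fst (hofib c) n.+1 w)))); last first.
  by move=> w; rewrite /interpolation /cone_cochain /= /fiber_cochain opprK if_same.
rewrite (coboundary_pullback (scomp (at_src _) (cylinder_fst _))).
by rewrite coboundary_path_primitive path_cocycle_src.
Qed.

Lemma interp_tgt y : interp (y, tgt n.+2) = 0.
Proof.
rewrite [LHS]/= -[(y, _)]/(at_tgt _ n.+2 y) -coboundary_pullback.
rewrite /coboundary big1 // => i _.
by rewrite /interpolation /cone_cochain /= path_primitive_tgt if_same mul0rz.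
Qed.

Definition hofib_homotopy : smap (sprod (hofib c) (Delta 1)) (hofib c) :=
  hofib_lift interp_src interp_tgt.

Lemma hofib_homotopy_src m (u : hofib c m) : hofib_homotopy m (u, src m) =
  primitive_lift fiber_cochain_normalized coboundary_fiber_cochain m u.
Proof.
(* Here the test in [interpolation] computes to true, so both path cocycles are the coboundary of
   the same cone. *)
exact: hofib_eq.
Qed.

Lemma hofib_homotopy_tgt m (u : hofib c m) : hofib_homotopy m (u, tgt m) = u.
Proof.
apply: hofib_eq => // r s.
(* Here [interpolation] is [path_primitive], a primitive of the original path cocycle. *)
by rewrite -smap_nat path_cocycle_lift -coboundary_path_primitive.
Qed.

Lemma path_cocycle_pt s : path_cocycle c (ptn (hofib c) n.+2, s) = 0.
Proof. by []. Qed.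

Lemma path_primitive_pt s : path_primitive (ptn (hofib c) n.+1, s) = 0.
Proof.
rewrite /path_primitive /fiber_integral big1 ?oppr0 // => i _.
by rewrite /prism act_ptn path_cocycle_pt mul0rz.
Qed.

Lemma hofib_homotopy_pt m s : hofib_homotopy m (ptn (hofib c) m, s) = ptn (hofib c) m.
Proof.
have zero w : w.1.1 = ptn (hofib c) n.+1 -> interpolation w = 0.
  move=> e; rewrite /interpolation e /cone_cochain /fiber_cochain !path_primitive_pt.
  by rewrite !oppr0 !if_same.
apply: hofib_eq => // r t.
rewrite -smap_nat path_cocycle_lift act_ptn path_cocycle_pt.
apply: big1 => i _; rewrite zero ?mul0rz //.
by rewrite -[LHS]/(act (coface i) (act r (ptn _ m))) !act_ptn.
Qed.
End Primitives.

(** * The nerve of the skeletal 2-group as pairs of a map and a cochain *)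

Section SkeletalNerve.
Local Open Scope ring_scope.
Variables (G : groupType) (A : zmodType) (alpha : G -> G -> G -> A).
Hypothesis alphaP : normalized_3cocycle alpha.

Let BG := BTwoGroup (discrete_twogroup G).
Let BGalpha := BTwoGroup (skel_twogroup alphaP).
Let proj : pmap BGalpha BG := Bmonfun (skel_proj alphaP).

Lemma skel_eq_cell (i j : unit) (f g : G) (e : f = g) :
  sval (@eq_cell (deloop (skel_moncat alphaP)) i j f g e) = 0.
Proof. by case: g / e. Qed.

(** The unit axioms of a lax functor equate these 2-cells with unitors, whose component in [A] is
    0. *)
Lemma skel_lax2_eq n (x : BGalpha n) (i j k : 'I_n.+1) p q r :
  i = j \/ j = k -> sval (@lax2 _ n x i j k p q r) = 0.
Proof.
case: x => F0 F1 F2 [F1_1 Fl Fr FA] /= [] e.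
  case: j / e p q => p q; have := congr1 sval (Fl i k p q).
  by rewrite /= [X in X + _ + _]skel_eq_cell !add0r (bool_irrelevance q r).
case: k / e q r => q r; have := congr1 sval (Fr i j q p).
by rewrite /= [X in _ + X + _]skel_eq_cell !add0r (bool_irrelevance p r).
Qed.

Lemma skel_lax2_val n (x : BGalpha n) (i j k i' j' k' : 'I_n.+1) p q r p' q' r' :
  i = i' :> nat -> j = j' :> nat -> k = k' :> nat ->
  sval (@lax2 _ n x i j k p q r) = sval (@lax2 _ n x i' j' k' p' q' r').
Proof.
move=> /val_inj ei /val_inj ej /val_inj ek; case: i' / ei p' r' => p' r'.
case: j' / ej p' q' => p' q'; case: k' / ek q' r' => q' r'.
by rewrite (bool_irrelevance p p') (bool_irrelevance q q') (bool_irrelevance r r').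
Qed.

Definition skel_cochain (x : BGalpha 2) : A :=
  sval (@lax2 _ 2 x (@Ordinal 3 0 isT) (@Ordinal 3 1 isT) (@Ordinal 3 2 isT) isT isT isT).

Lemma skel_cochain_normalized : normalized skel_cochain.
Proof.
move=> m t y /mono_ninj[i [j [eij etij]]]; rewrite /skel_cochain /=.
apply: skel_lax2_eq.
case: i j => [i lti] [j ltj] /= in eij etij *; subst j.
by case: i lti ltj etij => [|[|//]] lti ltj etij; [left|right];
  rewrite (bool_irrelevance lti isT) (bool_irrelevance ltj isT) in etij.
Qed.

(** This is the associativity axiom of the lax functor on the tetrahedron 0123, with the associator
    contributing [alpha]. *)
Lemma coboundary_skel_cochain x :
  coboundary skel_cochain x = - nerve_cocycle alphaP (proj 3 x).
Proof.
pose a i j k p q r ij jk ik : A :=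
  sval (@lax2 _ 3 x (@Ordinal 4 i p) (@Ordinal 4 j q) (@Ordinal 4 k r) ij jk ik).
pose face k : A := skel_cochain (lax_act (@coface 2 k) x).
have face_a (k : 'I_4) i j l (pi : (i < 4)%N) (pj : (j < 4)%N) (pl : (l < 4)%N)
    (ij : (i <= j)%N) (jl : (j <= l)%N) (il : (i <= l)%N) :
    [/\ bump k 0 = i, bump k 1 = j & bump k 2 = l] ->
    face k = a i j l pi pj pl ij jl il.
  by case=> *; apply: (skel_lax2_val x).
rewrite /coboundary (alternating_sum4 face).
rewrite (face_a _ 1 2 3 isT isT isT isT isT isT); last by split.
rewrite (face_a _ 0 2 3 isT isT isT isT isT isT); last by split.
rewrite (face_a _ 0 1 3 isT isT isT isT isT isT); last by split.
rewrite (face_a _ 0 1 2 isT isT isT isT isT isT); last by split.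
have E : a 0 1 2 isT isT isT isT isT isT + a 0 2 3 isT isT isT isT isT isT =
    nerve_cocycle alphaP (proj 3 x) +
    (a 1 2 3 isT isT isT isT isT isT + a 0 1 3 isT isT isT isT isT isT).
  have := congr1 sval (lax_assoc (lax_ax x) (i := @Ordinal 4 0 isT) (j := @Ordinal 4 1 isT)
    (k := @Ordinal 4 2 isT) (l := @Ordinal 4 3 isT) isT isT isT isT isT isT).
  by rewrite /= addr0 add0r.
move/(canLR (addrK _)): E => <-.
by rewrite opprB opprD [LHS](AC 4 (1 * 3 * (4 * 2))).
Qed.

Lemma triangle_le n (i j k : 'I_n.+1) : (i <= j)%N -> (j <= k)%N ->
  forall a b : 'I_3, (a <= b)%N ->
  (nth i [:: i; j; k] a <= nth i [:: i; j; k] b)%N.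
Proof.
move=> le_ij le_jk [[|[|[|//]]] ?] [[|[|[|//]]] ?] //= _.
exact: leq_trans le_jk.
Qed.

Definition triangle n (i j k : 'I_n.+1) (p : (i <= j)%N) (q : (j <= k)%N) : mono 2 n :=
  Mono (triangle_le p q).

Lemma tetrahedron_le n (i j k l : 'I_n.+1) : (i <= j)%N -> (j <= k)%N -> (k <= l)%N ->
  forall a b : 'I_4, (a <= b)%N ->
  (nth i [:: i; j; k; l] a <= nth i [:: i; j; k; l] b)%N.
Proof.
by move=> le_ij le_jk le_kl [[|[|[|[|//]]]] ?] [[|[|[|[|//]]]] ?] //= _; lia.
Qed.

Definition tetrahedron n (i j k l : 'I_n.+1) (p : (i <= j)%N) (q : (j <= k)%N)
  (r : (k <= l)%N) : mono 3 n := Mono (tetrahedron_le p q r).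

Lemma skel_cochain_triangle n (x : BGalpha n) (i j k : 'I_n.+1) p q r :
  skel_cochain (act (triangle p q) x) = sval (@lax2 _ n x i j k p q r).
Proof. by rewrite /skel_cochain /=; apply: skel_lax2_val. Qed.

(** Uniqueness of the simplex with a given projection and cochain: the projection has the same
    1-cells, and each 2-cell is the cochain on a [triangle]. *)
Lemma skel_nerve_eq n (x y : BGalpha n) : proj n x = proj n y ->
  (forall t : mono 2 n, skel_cochain (act t x) = skel_cochain (act t y)) -> x = y.
Proof.
move=> eproj ecochain.
have e1 i j p : @lax1 _ n x i j p = @lax1 _ n y i j p :> G.
  exact: (congr1 (fun w : BG n => @lax1 _ n w i j p : G) eproj).
have e2 i j k p q r : sval (@lax2 _ n x i j k p q r) = sval (@lax2 _ n y i j k p q r).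
  by rewrite -!skel_cochain_triangle.
case: x y {eproj ecochain} e1 e2 => [F0 F1 F2 ax] [F0' F1' F2' ax'].
have e0 : F0 = F0' by apply: functional_extensionality => i; case: (F0 i); case: (F0' i).
case: F0' / e0 F1' F2' ax' => F1' F2' ax' /= e1 e2.
apply: (@lax_eq (deloop (skel_moncat alphaP)) n F0 F1 F1' F2 F2' ax ax' e1) => *.
apply: skel_eq => /=.
by rewrite !skel_eq_cell !addr0 add0r.
Qed.

Lemma nerve_eq n (x y : BG n) :
  (forall i j p, @lax1 _ n x i j p = @lax1 _ n y i j p :> G) -> x = y.
Proof.
case: x y => [F0 F1 F2 ax] [F0' F1' F2' ax'].
have e0 : F0 = F0' by apply: functional_extensionality => i; case: (F0 i); case: (F0' i).
case: F0' / e0 F1' F2' ax' => F1' F2' ax' /= e1.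
apply: (@lax_eq (deloop (discrete_moncat G)) n F0 F1 F1' F2 F2' ax ax' e1) => * /=.
exact: proof_irrelevance.
Qed.

Section Lift.
Variables (Y : sset) (p : smap Y BG) (a : Y 2 -> A).
Hypotheses (aN : normalized a) (aC : forall y, coboundary a y = - nerve_cocycle alphaP (p 3 y)).

(** The unit axioms hold since [a] is normalized; the associativity axiom is the equation [aC] on a
    [tetrahedron]. *)
Lemma skel_lift_axioms n (y : Y n) : @lax_axioms (deloop (skel_moncat alphaP)) n (fun=> tt)
  (fun i j ij => @lax1 _ n (p n y) i j ij)
  (fun i j k ij jk ik =>
     exist _ (a (act (triangle ij jk) y)) (@lax2 _ n (p n y) i j k ij jk ik)).
Proof.
have degenerate i j k ij jk : i = j \/ j = k -> a (act (@triangle n i j k ij jk) y) = 0.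
  move=> e; apply: aN => tI; case: e => e.
    by have /(_ e) := tI (@Ordinal 3 0 isT) (@Ordinal 3 1 isT).
  by have /(_ e) := tI (@Ordinal 3 1 isT) (@Ordinal 3 2 isT).
have one_lax i ii : @lax1 _ n (p n y) i i ii = 1%g :> G by apply: nerve_lax1_eq.
apply: (@LaxAxioms (deloop (skel_moncat alphaP)) n (fun=> tt) _ _ one_lax)
  => [i j ii ij|i j jj ij|].
- by apply: skel_eq; rewrite /= [X in X + _ + _]skel_eq_cell !add0r degenerate //; left.
- by apply: skel_eq; rewrite /= [X in _ + X + _]skel_eq_cell !add0r degenerate //; right.
move=> i j k l ij jk kl ik jl il; apply: skel_eq; rewrite /= addr0 add0r.
pose q := tetrahedron ij jk kl.
have face m (t : mono 2 n) : mono_comp q (coface m) =1 t ->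
    a (act (coface m) (act q y)) = a (act t y).
  by move=> e; rewrite -act_comp (mono_eq e).
have := aC (act q y).
rewrite /coboundary (alternating_sum4 (fun m => a (act (coface m) (act q y)))).
rewrite (face _ (triangle jk kl)); last by case=> [[|[|[|]]] ?].
rewrite (face _ (triangle ik kl)); last by case=> [[|[|[|]]] ?].
rewrite (face _ (triangle ij jl)); last by case=> [[|[|[|]]] ?].
rewrite (face _ (triangle ij jk)); last by case=> [[|[|[|]]] ?].
have -> : nerve_cocycle alphaP (p 3 (act q y)) =
    alpha (lax1 (p n y) ij) (lax1 (p n y) jk) (lax1 (p n y) kl).
  by rewrite smap_nat; congr alpha; apply: (nerve_lax1 (p n y)).
move/(congr1 -%R); rewrite opprK => <-; rewrite !opprD !opprK.
by rewrite [RHS](AC (4 * 2) ((4 * 2) * ((1 * 5) * (3 * 6)))) /= !addNr !addr0.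
Qed.

Definition skel_lift_simplex n (y : Y n) : BGalpha n := Lax (skel_lift_axioms y).

Lemma proj_skel_lift n (y : Y n) : proj n (skel_lift_simplex y) = p n y.
Proof. exact: nerve_eq. Qed.

Lemma skel_cochain_lift n (y : Y n) (t : mono 2 n) :
  skel_cochain (act t (skel_lift_simplex y)) = a (act t y).
Proof.
rewrite /skel_cochain /=; congr (a (act _ _)).
by apply: mono_eq => -[[|[|[|]]] l] //=; congr (t _); apply: ord_inj.
Qed.

Program Definition skel_lift : smap Y BGalpha := @SMap Y BGalpha skel_lift_simplex _.
Next Obligation.
move=> m n t y; apply: skel_nerve_eq => [|r].
  by rewrite smap_nat !proj_skel_lift smap_nat.
by rewrite -act_comp !skel_cochain_lift act_comp.
Qed.
End Lift.
End SkeletalNerve.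

Lemma pointed_homotopic_eq (X Y : psset) (f g : pmap X Y) :
  (forall n x, f n x = g n x) -> pointed_homotopic f g.
Proof.
move=> efg; exists (scomp f (cylinder_fst X)); split=> //= n _.
by rewrite /ptn smap_nat pmap_pt.
Qed.

(** * The comparison equivalence and its compatibilities *)

Section Comparison.
Local Open Scope ring_scope.
Variables (G : groupType) (A : zmodType) (alpha : G -> G -> G -> A).
Hypothesis alphaP : normalized_3cocycle alpha.

Let BG := BTwoGroup (discrete_twogroup G).
Let BGalpha := BTwoGroup (skel_twogroup alphaP).
Let proj : pmap BGalpha BG := Bmonfun (skel_proj alphaP).
Let c : pmap BG (EM A 3) := classifying alphaP.

Definition skel_to_hofib_smap : smap BGalpha (hofib c) :=
  primitive_lift (@skel_cochain_normalized _ _ _ alphaP)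
    (@coboundary_skel_cochain _ _ _ alphaP).

Definition skel_to_hofib : pmap BGalpha (hofib c) :=
  @PMap BGalpha (hofib c) skel_to_hofib_smap (primitive_lift_pt _ _ (pmap_pt proj)).

Definition hofib_to_skel_smap : smap (hofib c) BGalpha :=
  skel_lift (@fiber_cochain_normalized _ _ _ (nerve_cocycle alphaP))
    (@coboundary_fiber_cochain _ _ _ (nerve_cocycle alphaP)).

Lemma hofib_to_skel_pt : hofib_to_skel_smap 0 (pt (hofib c)) = pt BGalpha.
Proof.
apply: skel_nerve_eq => [|t]; first by rewrite proj_skel_lift [RHS](pmap_pt proj).
rewrite skel_cochain_lift !normalized_pt //.
  exact: skel_cochain_normalized.
exact: fiber_cochain_normalized.
Qed.

Definition hofib_to_skel : pmap (hofib c) BGalpha :=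
  @PMap (hofib c) BGalpha hofib_to_skel_smap hofib_to_skel_pt.

Lemma skel_to_hofibK n (x : BGalpha n) : hofib_to_skel n (skel_to_hofib n x) = x.
Proof.
apply: skel_nerve_eq => [|t]; first exact: proj_skel_lift.
by rewrite skel_cochain_lift -smap_nat fiber_cochain_primitive_lift.
Qed.

Lemma hofib_to_skelK n (u : hofib c n) : skel_to_hofib n (hofib_to_skel n u) =
  primitive_lift (@fiber_cochain_normalized _ _ _ (nerve_cocycle alphaP))
    (@coboundary_fiber_cochain _ _ _ (nerve_cocycle alphaP)) n u.
Proof.
apply: hofib_eq => [|r s]; first exact: proj_skel_lift.
rewrite -!smap_nat !path_cocycle_primitive_lift proj_skel_lift /cross_cochain /=.
by rewrite skel_cochain_lift.
Qed.

Lemma skel_to_hofib_equivalence : pointed_equivalence skel_to_hofib.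
Proof.
exists hofib_to_skel; split; first exact/pointed_homotopic_eq/skel_to_hofibK.
exists (hofib_homotopy (nerve_cocycle alphaP)); split=> n u.
- by rewrite hofib_homotopy_src -hofib_to_skelK.
- exact: hofib_homotopy_tgt.
exact: hofib_homotopy_pt.
Qed.

(** The triangle under [BA] commutes strictly: over the base point [alpha] vanishes, and the cone
    construction leaves just the cross product that defines [EM_loop]. *)
Lemma skel_to_hofib_incl n (y : BTwoGroup (oneobj_twogroup A) n) :
  skel_to_hofib n (Bmonfun (skel_incl alphaP) n y) =
  ext_incl (hofib_extension c) n y.
Proof.
apply: hofib_eq => [|r s]; first exact: nerve_eq.
rewrite -!smap_nat path_cocycle_primitive_lift; set w := act r y.
have -> : nerve_cocycle alphaP (proj 3 (Bmonfun (skel_incl alphaP) 3 w)) = 0.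
  by apply: (proj2 alphaP); left.
rewrite path_cocycle_val /= /cross_cochain /= /skel_cochain /= add0r.
(* The sign of the cone is [(-1) ^+ 2 = 1] in this degree, in agreement with the convention of
   [EM_loop]. *)
rewrite sqrrN expr1n mulr1z interval_end.
by case: ifP => s0; rewrite /= ?s0 /= ?andbF ?andbT.
Qed.
End Comparison.

Theorem theorem8p1 (G : groupType) (A : zmodType) (alpha : G -> G -> G -> A)
    (alphaP : normalized_3cocycle alpha) :
  extension_equivalent (skel_extension alphaP) (hofib_extension (classifying alphaP)).
Proof.
exists (skel_to_hofib alphaP); split; first exact: skel_to_hofib_equivalence.
  exact: pointed_homotopic_eq.
by apply: pointed_homotopic_eq => n y; apply: skel_to_hofib_incl.
Qed.
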